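(* Let $D$ be the Dehn invariant for hyperbolic scissors congruence in dimension $d$, i.e. $D=\bigoplus_{0<i<d}\hat D_i$ on $\mathcal P(\mathcal H^d)$. There is a homomorphism $$H_d\big(O(1,d;\mathbb R);\mathbb Z[\tfrac12]^\sigma\big)\longrightarrow \ker D$$ which, after composition with volume, is equal to the Cheeger--Chern--Simons class $\mathrm{CCS}:H_d(O(1,d;\mathbb R);\mathbb Z[\tfrac12]^\sigma)\to\mathbb R$. Thus, if this map is surjective and the Cheeger--Chern--Simons class is injective, volume and the Dehn invariant separate scissors congruence classes in hyperbolic geometry in all dimensions (the hypothesis for a given $d$ giving the conclusion in dimension $d$).
   Context: All groups are regarded as discrete groups, so $H_*$ is group homology. Hyperbolic space. $O(1,d;\mathbb R)$ is the full group of linear automorphisms of $\mathbb R^{d+1}$ preserving the form $-x_0^2+x_1^2+\dots+x_d^2$. $\mathcal H^d$ is one of the two sheets of the hyperboloid $-x_0^2+x_1^2+\dots+x_d^2=-1$; a point of $\mathcal H^d$ is identified with the line through the origin that it spans, and $O(1,d;\mathbb R)$ acts on points of $\mathcal H^d$ through its action on lines. $\mathbb Z[\frac12]^\sigma$ is $\mathbb Z[\frac12]$ with $g$ acting by multiplication by $\det g$. Scissors congruence groups. A $d$-simplex in $\mathcal H^d$ (resp. in the unit sphere $S^d\subset\mathbb R^{d+1}$) is the intersection of $\mathcal H^d$ (resp. $S^d$) with the cone $\{\sum c_ib_i: c_i\ge0\}$ over $d+1$ linearly independent vectors $b_0,\dots,b_d$ in $\mathcal H^d$ (resp. $S^d$).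 A polytope is a finite union of $d$-simplices. $\hat{\mathcal P}(X)$, for $X=\mathcal H^d$ or $S^d$, is the free abelian group on polytopes in $X$ modulo $[P\cup Q]=[P]+[Q]$ if $P\cap Q$ is contained in a finite union of $(d-1)$-dimensional subspaces, and $[P]=[gP]$ for $g$ in the isometry group ($O(1,d;\mathbb R)$, resp. $O(d+1;\mathbb R)$). Put $\mathcal P(\mathcal H^d)=\hat{\mathcal P}(\mathcal H^d)$, and let $\mathcal P(S^d)$ be the quotient of $\hat{\mathcal P}(S^d)$ by all suspensions (the union of the two simplices obtained by adjoining to a $(d-1)$-simplex in $V\cap S^d$, $\dim V=d$, one of the two unit vectors of $V^\perp$). These groups are taken with $2$ inverted. Dehn invariant. For $0<i<d$ the homomorphism $\hat D_i:\mathcal P(\mathcal H^d)\to\mathcal P(\mathcal H^i)\otimes\mathcal P(S^{d-i-1})$ sends the simplex with vertices $x_0,\dots,x_d$ to $\sum [x_J]\otimes[\mathrm{pr}_{U^\perp}(x_{J'})]$, the sum over $J\sqcup J'=\{0,\dots,d\}$ with $|J|=i+1$, where $U=\mathrm{span}(x_j:j\in J)$, $[x_J]$ is the class of the simplex with vertices $x_j$ ($j\in J$) in $U\cap \mathcal H^d\cong\mathcal H^i$, and $[\mathrm{pr}_{U^\perp}(x_{J'})]$ is the class of the spherical simplex spanned by the projections of the $x_j$ ($j\in J'$) to $U^\perp$. Volume is the homomorphism $\mathrm{vol}:\mathcal P(\mathcal H^d)\to\mathbb R$ given by hyperbolic volume. Cheeger--Chern--Simons class. Fix $x_0\in\mathcal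 H^d\cong O^+(1,d;\mathbb R)/O(d;\mathbb R)$. A chain in degree $d$ is represented by tuples $(g_1,\dots,g_d)$ of elements of $O(1,d;\mathbb R)$; the Cheeger--Chern--Simons construction $H_d(O(1,d;\mathbb R);\mathbb Z[\frac12]^\sigma)\to\mathcal P(\mathcal H^d)$ is induced by sending $(g_1,\dots,g_d)$ to the class of the geodesic simplex $(x_0,\ g_dx_0,\ g_dg_{d-1}x_0,\ \dots,\ g_d\cdots g_1x_0)$, and $\mathrm{CCS}$ is its composition with $\mathrm{vol}$. *)

(* Defs.v *)
(* The field of real numbers is an arbitrary realType. *)
From HB Require Import structures.
From mathcomp Require Import all_boot all_order all_algebra.
From mathcomp Require Import ring_quotient.
From mathcomp Require Import all_classical all_reals all_analysis.
From mathcomp Require Import freeg.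

Set Implicit Arguments.
Unset Strict Implicit.
Unset Printing Implicit Defensive.

Import Order.TTheory GRing.Theory Num.Theory.
Import numFieldNormedType.Exports.

Local Open Scope classical_set_scope.
Local Open Scope quotient_scope.
Local Open Scope ring_scope.

Definition zhalf_pred : {pred rat} :=
  fun x => `[< exists n : nat, x * 2 ^+ n \is a Num.int >].

Lemma zhalf_closed : subring_closed zhalf_pred.
Proof.
split.
- by apply/asboolP; exists 0%N; rewrite mulr1.
- move=> x y /asboolP[m xm] /asboolP[n yn]; apply/asboolP; exists (m + n)%N.
  by rewrite exprD mulrBl mulrA (mulrC (2 ^+ m)) mulrA rpredB // rpredM // rpredX.
- move=> x y /asboolP[m xm] /asboolP[n yn]; apply/asboolP; exists (m + n)%N.
  by rewrite exprD mulrACA rpredM.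
Qed.

HB.instance Definition _ := GRing.isSubringClosed.Build rat zhalf_pred zhalf_closed.

Record zhalf := ZHalf { zhalf_val :> rat; _ : zhalf_pred zhalf_val }.
HB.instance Definition _ := [isSub for zhalf_val].
HB.instance Definition _ := [Choice of zhalf by <:].
HB.instance Definition _ := [SubChoice_isSubComNzRing of zhalf by <:].

Section Quotient.
Variables (k : nzRingType) (V : lmodType k) (S : set V).

Definition is_submodule (W : set V) :=
  W 0 /\ forall (a : k) (u v : V), W u -> W v -> W (a *: u + v).

Definition lspan : set V :=
  [set v | forall W, is_submodule W -> S `<=` W -> W v].

Definition lspan_pred : {pred V} := fun v => `[< lspan v >].

Lemma lspan_submod_closed : submod_closed lspan_pred.
Proof.
split; first by apply/asboolP => W [].
move=> a u v /asboolP su /asboolP sv; apply/asboolP => W sW SW.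
by apply: sW.2; [exact: su | exact: sv].
Qed.

HB.instance Definition _ :=
  GRing.isSubmodClosed.Build k V lspan_pred lspan_submod_closed.

Definition lquot : Type := Quotient.quot lspan_pred.
HB.instance Definition _ := GRing.Zmodule.on lquot.

Definition lclass (v : V) : lquot := \pi_(Quotient.quot lspan_pred) v.

Lemma lclassK (q : lquot) : lclass (repr (q : Quotient.quot lspan_pred)) = q.
Proof. exact: reprK. Qed.

Lemma lclass_eqP u v : reflect (lclass u = lclass v) (u - v \in lspan_pred).
Proof. by rewrite Quotient.idealrBE; exact: eqP. Qed.

Lemma lclassD u v : lclass (u + v) = lclass u + lclass v.
Proof. exact: raddfD. Qed.

Definition lquot_scale (a : k) (q : lquot) : lquot :=
  lclass (a *: repr (q : Quotient.quot lspan_pred)).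

Lemma lquot_scaleE a v : lquot_scale a (lclass v) = lclass (a *: v).
Proof.
apply/lclass_eqP; rewrite -scalerBr rpredZ //; apply/lclass_eqP.
exact: lclassK.
Qed.

Lemma lquot_scalerA a b q :
  lquot_scale a (lquot_scale b q) = lquot_scale (a * b) q.
Proof. by rewrite -(lclassK q) !lquot_scaleE scalerA. Qed.

Lemma lquot_scale1r : left_id 1 lquot_scale.
Proof. by move=> q; rewrite -(lclassK q) !lquot_scaleE scale1r. Qed.

Lemma lquot_scalerDr : right_distributive lquot_scale +%R.
Proof.
move=> a p q; rewrite -(lclassK q) -(lclassK p) -lclassD !lquot_scaleE.
by rewrite scalerDr lclassD.
Qed.

Lemma lquot_scalerDl q : {morph lquot_scale^~ q : a b / a + b}.
Proof.
by move=> a b; rewrite -(lclassK q) !lquot_scaleE scalerDl lclassD.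
Qed.

HB.instance Definition _ := GRing.Zmodule_isLmodule.Build k lquot
  lquot_scalerA lquot_scale1r lquot_scalerDr lquot_scalerDl.

Lemma lclass_is_linear : linear lclass.
Proof. by move=> a u v; rewrite lclassD -lquot_scaleE. Qed.

HB.instance Definition _ :=
  GRing.isLinear.Build k V lquot *:%R lclass lclass_is_linear.

End Quotient.

Section Tensor.
Variables (k : comNzRingType) (U V : lmodType k).

Definition bilinear_relation : set {freeg (U * V)%type / k} :=
  [set r | (exists (u u' : U) (v : V),
              r = << (u + u', v) >> - << (u, v) >> - << (u', v) >>)
        \/ (exists (u : U) (v v' : V),
              r = << (u, v + v') >> - << (u, v) >> - << (u, v') >>)
        \/ (exists (a : k) (u : U) (v : V),
              r = << (a *: u, v) >> - a *: << (u, v) >>)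
        \/ (exists (a : k) (u : U) (v : V),
              r = << (u, a *: v) >> - a *: << (u, v) >>)].

Definition tensor : Type := lquot bilinear_relation.
HB.instance Definition _ := GRing.Lmodule.on tensor.

Definition tens (u : U) (v : V) : tensor :=
  lclass bilinear_relation << (u, v) >>.

End Tensor.

Lemma fglift_linear (k : comNzRingType) (K : choiceType) (M : lmodType k)
  (f : K -> M) : linear (fglift f).
Proof.
move=> a u v; have fB := @lift_is_additive k K M f.
have f0 : fglift f 0 = 0 by rewrite -(subrr (0 : {freeg K / k})) fB subrr.
have fN w : fglift f (- w) = - fglift f w by rewrite -sub0r fB f0 sub0r.
have fD w w' : fglift f (w + w') = fglift f w + fglift f w'.
  by rewrite -[w']opprK fB !fN.
rewrite fD; congr (_ + _).
have fsum (r : seq K) (F : K -> {freeg K / k}) :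
    fglift f (\sum_(x <- r) F x) = \sum_(x <- r) fglift f (F x).
  by elim: r => [|x r IH]; rewrite ?big_nil // !big_cons fD IH.
rewrite -{2}(freeg_sumE u) fsum scaler_sumr.
rewrite [a *: u]/(fgscale a u) /fgscale fsum.
by apply: eq_bigr => x _; rewrite !liftU scalerA.
Qed.

(* The bar complex of a (discrete) group [G] with coefficients in [k], on which
   [g] acts as multiplication by [chi g].  The tuple [(g_1, ..., g_n)] stands
   for the simplex with vertices [1, g_n, g_n g_(n-1), ..., g_n ... g_1], taken
   up to left translation by [G]. *)
Section GroupHomology.
Variables (G : groupType) (k : comNzRingType) (chi : G -> k).

Definition bar_chain (n : nat) := {freeg (n.-tuple G) / k}.

(* The face of [g = (g_1, ..., g_(n+1))] which omits the vertex number [n+1-p]: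
   it drops [g_1] if [p = 0], drops [g_(n+1)] if [p = n+1], and otherwise
   replaces the entries [g_p, g_(p+1)] by [g_(p+1) g_p]. *)
Definition face (n : nat) (g : n.+1.-tuple G) (p : 'I_n.+2) : n.-tuple G :=
  [tuple (if (j.+1 < p)%N then nth 1 g j
          else if (j.+1 == p)%N then nth 1 g j.+1 * nth 1 g j
          else nth 1 g j.+1)%g | j < n].

(* When the initial vertex [1] is omitted ([p = n+1]) the remaining simplex has
   to be translated back by the inverse of its first vertex [g_(n+1)]. *)
Definition face_coef (n : nat) (g : n.+1.-tuple G) (p : 'I_n.+2) : k :=
  (-1) ^+ p * (if p == ord_max then chi (tnth g ord_max)^-1%g else 1).

Definition bar_boundary (n : nat) : bar_chain n.+1 -> bar_chain n :=
  fglift (fun g => \sum_(p < n.+2) << face_coef g p *g face g p >>).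

Definition cycle_pred (n : nat) : {pred bar_chain n} :=
  match n with
  | 0 => fun=> true
  | m.+1 => fun z => bar_boundary z == 0
  end.

Lemma cycle_submod_closed n : submod_closed (@cycle_pred n).
Proof.
case: n => [|n]; first by split.
have dB : linear (@bar_boundary n) by exact: fglift_linear.
split=> [|a u v].
  by have := dB (-1) 0 0; rewrite scaler0 addr0 scaleN1r addNr => /eqP.
by move=> /eqP u0 /eqP v0; apply/eqP; rewrite dB u0 v0 scaler0 addr0.
Qed.

HB.instance Definition _ n :=
  GRing.isSubmodClosed.Build k (bar_chain n) (@cycle_pred n) (cycle_submod_closed n).

Record bar_cycle (n : nat) :=
  Cycle { cycle_chain :> bar_chain n; _ : cycle_pred cycle_chain }.

HB.instance Definition _ n := [isSub for @cycle_chain n].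
HB.instance Definition _ n := [Choice of bar_cycle n by <:].
HB.instance Definition _ n := [SubChoice_isSubLmodule of bar_cycle n by <:].

Definition is_boundary (n : nat) : set (bar_cycle n) :=
  [set z | exists w, cycle_chain z = bar_boundary w].

Definition homology (n : nat) : Type := lquot (@is_boundary n).
HB.instance Definition _ n := GRing.Lmodule.on (homology n).

Definition homology_class (n : nat) (z : bar_cycle n) : homology n :=
  lclass (@is_boundary n) z.

End GroupHomology.

Section Geometry.
Variable R : realType.

Definition lorentz_mx (d : nat) : 'M[R]_d.+1 :=
  diag_mx (\row_j (if j == 0 then -1 else 1)).

Definition hyperbolic (d : nat) : set 'cV[R]_d.+1 :=
  [set v | (v^T *m lorentz_mx d *m v) 0 0 = -1 /\ 0 < v 0 0].

Definition usphere (d : nat) : set 'cV[R]_d.+1 :=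
  [set v | (v^T *m v) 0 0 = 1].

Arguments lorentz_mx : clear implicits.
Arguments hyperbolic : clear implicits.
Arguments usphere : clear implicits.

Section LorentzGroup.
Variable d : nat.
Local Notation J := (lorentz_mx d).

Definition lorentz_pred : {pred 'M[R]_d.+1} := fun g => g^T *m J *m g == J.

Record lorentz :=
  Lorentz { lorentz_val :> 'M[R]_d.+1; _ : lorentz_pred lorentz_val }.

HB.instance Definition _ := [isSub for lorentz_val].
HB.instance Definition _ := [Choice of lorentz by <:].

Lemma lorentz_mxK : J *m J = 1%:M.
Proof.
rewrite mulmx_diag -diag_const_mx; congr diag_mx; apply/rowP => j.
by rewrite !mxE; case: ifP; rewrite ?mulrNN mulr1.
Qed.

Lemma lorentz_left_inv g : lorentz_pred g -> J *m g^T *m J *m g = 1%:M.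
Proof. by move=> /eqP gP; rewrite -!mulmxA (mulmxA g^T) gP lorentz_mxK. Qed.

Lemma lorentz_one_subproof : lorentz_pred 1%:M.
Proof. by rewrite /lorentz_pred trmx1 mul1mx mulmx1. Qed.

Lemma lorentz_mul_subproof (g h : lorentz) : lorentz_pred (val g *m val h).
Proof.
have /eqP gP := valP g; have /eqP hP := valP h; apply/eqP.
by rewrite trmx_mul !mulmxA -(mulmxA (val h)^T) -(mulmxA (val h)^T) gP.
Qed.

Lemma lorentz_inv_subproof (g : lorentz) : lorentz_pred (J *m (val g)^T *m J).
Proof.
apply/eqP; set h := val g.
have gV : h *m (J *m h^T *m J) = 1%:M by apply: mulmx1C; exact: lorentz_left_inv (valP g).
have JT : J^T = J by rewrite tr_diag_mx.
rewrite !trmx_mul trmxK JT !mulmxA -(mulmxA _ J J) lorentz_mxK mulmx1.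
by rewrite -!mulmxA (mulmxA J h^T) gV mulmx1.
Qed.

Definition lorentz_one := Lorentz lorentz_one_subproof.
Definition lorentz_mul g h := Lorentz (lorentz_mul_subproof g h).
Definition lorentz_inv g := Lorentz (lorentz_inv_subproof g).

Fact lorentz_mulA : associative lorentz_mul.
Proof. by move=> f g h; apply: val_inj; rewrite /= mulmxA. Qed.

Fact lorentz_mul1 : left_id lorentz_one lorentz_mul.
Proof. by move=> g; apply: val_inj; rewrite /= mul1mx. Qed.

Fact lorentz_mulr1 : right_id lorentz_one lorentz_mul.
Proof. by move=> g; apply: val_inj; rewrite /= mulmx1. Qed.

Fact lorentz_mulV : left_inverse lorentz_one lorentz_inv lorentz_mul.
Proof. by case=> g gP; apply: val_inj; rewrite /= lorentz_left_inv. Qed.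

Fact lorentz_mulrV : right_inverse lorentz_one lorentz_inv lorentz_mul.
Proof.
by case=> g gP; apply: val_inj => /=; apply: mulmx1C; rewrite lorentz_left_inv.
Qed.

HB.instance Definition _ := isGroup.Build lorentz lorentz_mulA lorentz_mul1
  lorentz_mulr1 lorentz_mulV lorentz_mulrV.

(* The action on points of hyperbolic space is the action on lines: if [g]
   exchanges the two sheets, then the image of [v] is [- (g *m v)]. *)
Definition lorentz_act (g : lorentz) (v : 'cV[R]_d.+1) : 'cV[R]_d.+1 :=
  Num.sg ((val g *m v) 0 0) *: (val g *m v).

(* [\det g], which is 1 or -1, viewed in Z[1/2]. *)
Definition det_sign (g : lorentz) : zhalf := (sgz (\det (val g)))%:~R.

End LorentzGroup.

Section Scissors.
Variables (d : nat) (X : set 'cV[R]_d.+1).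

Definition cone (m : nat) (I : {set 'I_m}) (b : 'M[R]_(d.+1, m)) :
    set 'cV[R]_d.+1 :=
  [set v | exists2 c : 'I_m -> R, forall i, 0 <= c i &
           v = \sum_(i in I) c i *: col i b].

Definition cone_section (m : nat) (I : {set 'I_m}) (b : 'M[R]_(d.+1, m)) :=
  X `&` cone I b.

Definition simplex (b : 'M[R]_d.+1) := cone_section finset.setT b.

Definition is_simplex (A : set 'cV[R]_d.+1) :=
  exists b : 'M[R]_d.+1,
    [/\ b \in unitmx, forall j, X (col j b) & A = simplex b].

Definition is_polytope (A : set 'cV[R]_d.+1) :=
  exists n (B : 'I_n -> set 'cV[R]_d.+1),
    (forall i, is_simplex (B i)) /\ A = \bigcup_i B i.

Record polytope :=
  Polytope { polytope_set :> set 'cV[R]_d.+1; _ : `[< is_polytope polytope_set >] }.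

HB.instance Definition _ := [isSub for polytope_set].
HB.instance Definition _ := [Choice of polytope by <:].

(* A [(d-1)]-dimensional subspace of [X] is cut out by a linear subspace of
   dimension [d]. *)
Definition is_thin (A : set 'cV[R]_d.+1) :=
  exists s : seq {vspace 'cV[R]_d.+1},
    (forall W, W \in s -> \dim W = d) /\
    (forall v, A v -> exists2 W, W \in s & v \in W).

(* [isom] is the isometry group of [X]; the polytopes in [N] are set to zero. *)
Variables (isom : set ('cV[R]_d.+1 -> 'cV[R]_d.+1)) (N : set (set 'cV[R]_d.+1)).

Definition scissors_relation : set {freeg polytope / zhalf} :=
  [set r | (exists P Q U : polytope,
              [/\ is_thin (P `&` Q), U = P `|` Q :> set _ &
                  r = << U >> - (<< P >> + << Q >>)])
        \/ (exists (P Q : polytope) g,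
              [/\ isom g, Q = g @` P :> set _ & r = << P >> - << Q >>])
        \/ (exists2 P : polytope, N P & r = << P >>)].

(* Generators and relations over [Z[1/2]], i.e. with 2 inverted. *)
Definition scissors : Type := lquot scissors_relation.
HB.instance Definition _ := GRing.Lmodule.on scissors.

(* Total on sets, with the value 0 if [A] is not a polytope. *)
Definition scissors_class (A : set 'cV[R]_d.+1) : scissors :=
  if insub A is Some P then lclass scissors_relation << P >> else 0.

End Scissors.

Definition hyp_isometries (d : nat) : set ('cV[R]_d.+1 -> 'cV[R]_d.+1) :=
  range (@lorentz_act d).

Definition sphere_isometries (d : nat) : set ('cV[R]_d.+1 -> 'cV[R]_d.+1) :=
  [set f | exists2 g : 'M[R]_d.+1, g^T *m g = 1%:M & f = mulmx g].

(* [b] consists of a [(d-1)]-simplex (the columns other than the last one) and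
   of a unit vector orthogonal to it. *)
Definition suspension (d : nat) : set (set 'cV[R]_d.+1) :=
  [set A | exists b : 'M[R]_d.+1,
     [/\ b \in unitmx, forall j, usphere d (col j b),
         forall j, j != ord_max -> ((col j b)^T *m col ord_max b) 0 0 = 0 &
         A = simplex (usphere d) b `|`
             simplex (usphere d)
               (\matrix_(i, j) (if j == ord_max then - b i j else b i j))]].

Definition PH (d : nat) : Type :=
  scissors (hyperbolic d) (@hyp_isometries d) set0.
HB.instance Definition _ d := GRing.Lmodule.on (PH d).

Definition PS (d : nat) : Type :=
  scissors (usphere d) (@sphere_isometries d) (@suspension d).
HB.instance Definition _ d := GRing.Lmodule.on (PS d).

Definition hclass (d : nat) (A : set 'cV[R]_d.+1) : PH d :=
  scissors_class (hyperbolic d) (@hyp_isometries d) set0 A.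

Definition sclass (d : nat) (A : set 'cV[R]_d.+1) : PS d :=
  scissors_class (usphere d) (@sphere_isometries d) (@suspension d) A.

(* Orthonormal coordinates on [U = span (x_j : j in I)], given by an isometry
   [A] from R^(1,i) onto [U] which preserves the sheets of the hyperboloids,
   and on its (positive definite) Lorentz orthogonal, given by an isometry [B]
   from R^(m+1) into R^(1,d). *)
Definition adapted_frame (d i m : nat) (x : 'M[R]_d.+1) (I : {set 'I_d.+1})
    (A : 'M[R]_(d.+1, i.+1)) (B : 'M[R]_(d.+1, m.+1)) :=
  [/\ A^T *m lorentz_mx d *m A = lorentz_mx i /\ 0 < A 0 0,
      forall j, j \in I -> exists y, col j x = A *m y,
      B^T *m lorentz_mx d *m B = 1%:M &
      A^T *m lorentz_mx d *m B = 0].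

(* In the coordinates given by [A], the vector [x_j], [j in I], is the column
   [j] of [lorentz_mx i *m A^T *m lorentz_mx d *m x].  In those given by [B],
   the projection of [x_j] to the orthogonal of [U] is the column [j] of
   [B^T *m lorentz_mx d *m x]; the spherical simplex only depends on the rays
   spanned by the projections, which need not be normalised. *)
Definition dehn_term (d i m : nat) (x : 'M[R]_d.+1) (I : {set 'I_d.+1})
    (A : 'M[R]_(d.+1, i.+1)) (B : 'M[R]_(d.+1, m.+1)) : tensor (PH i) (PS m) :=
  tens (hclass (cone_section (hyperbolic i) I
                  (lorentz_mx i *m A^T *m lorentz_mx d *m x)))
       (sclass (cone_section (usphere m) (~: I) (B^T *m lorentz_mx d *m x))).

Definition is_dehn (d i : nat)
    (D : {linear PH d -> tensor (PH i) (PS (d - i - 1))}) :=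
  forall (x : 'M[R]_d.+1)
    (A : {set 'I_d.+1} -> 'M[R]_(d.+1, i.+1))
    (B : {set 'I_d.+1} -> 'M[R]_(d.+1, (d - i - 1).+1)),
  x \in unitmx -> (forall j, hyperbolic d (col j x)) ->
  (forall I : {set 'I_d.+1}, #|I| = i.+1 -> adapted_frame x I (A I) (B I)) ->
  D (hclass (simplex (hyperbolic d) x)) =
    \sum_(I : {set 'I_d.+1} | #|I| == i.+1) dehn_term x I (A I) (B I).

(* The integral over R^n of a nonnegative Borel function, as an iterated
   Lebesgue integral. *)
Fixpoint iterated_integral (n : nat) : ('cV[R]_n -> \bar R) -> \bar R :=
  match n with
  | 0 => fun f => f 0
  | n'.+1 => fun f =>
      (\int[@lebesgue_measure R]_t
         iterated_integral (fun w : 'cV[R]_n' => f (col_mx t%:M w)))%E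
  end.

(* Hyperbolic space is the graph of [sqrt (1 + |w|^2)] over R^d, and the
   hyperbolic volume form is [dw / sqrt (1 + |w|^2)]. *)
Definition hyp_height (d : nat) (w : 'cV[R]_d) : R :=
  Num.sqrt (1 + (w^T *m w) 0 0).

Definition hyp_volume (d : nat) (A : set 'cV[R]_d.+1) : \bar R :=
  iterated_integral (fun w : 'cV[R]_d =>
    (\1_A (col_mx (hyp_height w)%:M w : 'cV[R]_d.+1) / hyp_height w)%:E).

Definition is_volume (d : nat) (vol : {additive PH d -> R}) :=
  forall P : polytope (hyperbolic d), (vol (hclass P))%:E = hyp_volume P.

Definition HO (d n : nat) : Type := homology (@det_sign d) n.
HB.instance Definition _ d n := GRing.Lmodule.on (HO d n).

(* The points [x0, g_d x0, g_d g_(d-1) x0, ..., g_d ... g_1 x0]. *)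
Definition ccs_vertices (d : nat) (x0 : 'cV[R]_d.+1) (g : d.-tuple (lorentz d)) :
    'M[R]_d.+1 :=
  \matrix_(i, j) lorentz_act (\prod_(h <- take j (rev g)) h)%g x0 i 0.

(* The orientation of a tuple of points of hyperbolic space, regarded as lines:
   the mean of the signs of [\det x] and of [\det (- x)], which are the two
   choices of representatives of the lines in a common sheet.  This is the
   function to {-1, 0, 1} which, for the action on lines, is multiplied by
   [\det g] under every [g] in O(1,d), as required by the coefficients.  If [d]
   is odd it is the sign of [\det x]; if [d] is even it vanishes, and so does
   the homology of O(1,d) with these coefficients, because the central element
   [-1] acts on them by [-1]. *)
Definition orientation (d : nat) (x : 'M[R]_d.+1) : zhalf :=
  if odd d then (sgz (\det x))%:~R else 0.

(* The class of the oriented geodesic simplex with vertices [x_0, ..., x_d];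
   it is zero if the points are linearly dependent. *)
Definition oriented_class (d : nat) (x : 'M[R]_d.+1) : PH d :=
  orientation x *: hclass (simplex (hyperbolic d) x).

Definition ccs_chain (d : nat) (x0 : 'cV[R]_d.+1) :
    bar_chain (lorentz d) zhalf d -> PH d :=
  fglift (fun g => oriented_class (ccs_vertices x0 g)).

Definition is_ccs (d : nat) (x0 : 'cV[R]_d.+1) (ccs : {linear HO d d -> PH d}) :=
  forall z : bar_cycle (@det_sign d) d, ccs (homology_class z) = ccs_chain x0 z.

End Geometry.

Arguments lorentz_mx : clear implicits.
Arguments lorentz : clear implicits.
Arguments hyperbolic : clear implicits.
Arguments usphere : clear implicits.
Arguments PH : clear implicits.
Arguments PS : clear implicits.
Arguments HO : clear implicits.

(* Main.v *)
Require Import Defs.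
From mathcomp Require Import ring_quotient freeg perm.
From HB Require Import structures.
From mathcomp Require Import all_boot all_order all_algebra.
From mathcomp Require Import all_classical all_reals all_analysis.
From mathcomp Require Import ring lra zify.

Set Implicit Arguments.
Unset Strict Implicit.
Unset Printing Implicit Defensive.

Import Order.TTheory GRing.Theory Num.Theory.

Local Open Scope classical_set_scope.
Local Open Scope ring_scope.

(** The homomorphism is the Cheeger-Chern-Simons construction itself: the
    composition with volume is then the required class by definition, and if it
    is injective and maps onto the kernel of the Dehn invariant, two classes
    with the same volume and Dehn invariant differ by the image of a homology
    class of volume zero. What has to be proved is that the construction
    vanishes on boundaries and that the Dehn invariant vanishes on its values on
    cycles. For even [d] the orientation is zero and so is the construction;
    from now on [d] is odd.

    Both statements rest on one fact about cones. If [n + 2] vectors in a space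
    of dimension [n + 1] satisfy a linear relation, and are otherwise
    independent, then the cones that omit a
    vector with positive coefficient and the cones that omit a vector with
    negative coefficient dissect the same cone ([dissect_by_positive]), so the
    classes of these simplices, with the signs of the coefficients, add up to
    zero ([flip]). For points of hyperbolic space both signs always occur
    ([hyperbolic_flip]). On the sphere modulo suspensions negating a vertex only
    changes the sign of a class, because a lune is a suspension
    ([sclass_negate_last]), so the relation holds for all nonzero vectors
    ([sphere_flip]). The coefficients given by Cramer's rule turn these
    relations into cocycle relations for oriented simplices; for [PH d] this is
    [oriented_class_cocycle], which makes the construction well defined on
    homology.

    The Dehn invariant of an oriented simplex is a sum over the subspaces [U]
    spanned by [i + 1] of its vertices. Fix [U], encoded by the Lorentz
    orthogonal projector [P] onto it. To a tuple of vectors of which exactly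
    [i + 1] lie in [U], assign the class of the simplex that these span in [U],
    tensored with that of the projection of the others to the orthogonal of [U],
    and with the orientation of the whole tuple as coefficient; to any other
    tuple assign zero. This is a cocycle ([oriented_dehn_cocycle]), and it
    vanishes on all tuples that avoid [U]. Now replace the vertices of a simplex
    [(g_0 x_0, ..., g_d x_0)] that lie in [U] by vectors outside [U]. The
    prism between the old and the new simplex shows that the Dehn invariant is a
    coboundary ([coboundary_prism]). The replacements can be chosen
    equivariantly, although [U] has a large stabiliser, because they may depend
    on the group element [g_k] and not only on the point [g_k x_0]
    ([outside_vector]). Summed over all [U], the prism thus gives an equivariant
    cochain whose coboundary is the Dehn invariant of the construction, which
    therefore vanishes on cycles ([dehn_ccs_chain]). *)

(** * Quotients, tensors and formal linear combinations *)

Lemma lquot_lift (k : nzRingType) (V W : lmodType k) (S : set V)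
    (phi : {linear V -> W}) :
  (forall v, S v -> phi v = 0) ->
  exists psi : {linear lquot S -> W}, forall v, psi (lclass S v) = phi v.
Proof.
move=> phiS; pose psi (q : lquot S) : W := phi (repr (q : Quotient.quot _)).
have psiE v : psi (lclass S v) = phi v.
  apply/eqP; rewrite -subr_eq0 -linearB; apply/eqP.
  have /asboolP/(_ [set w | phi w = 0]) :
      repr (lclass S v : Quotient.quot _) - v \in lspan_pred S.
    by apply/lclass_eqP; exact: lclassK.
  apply=> //; split=> [|a u w /=]; first exact: linear0.
  by rewrite /= linearP => -> ->; rewrite scaler0 addr0.
have psi_linear : linear psi.
  move=> a p q; rewrite -(lclassK p) -(lclassK q) -linearP !psiE.
  by rewrite linearP.
pose L := GRing.isLinear.Build k (lquot S) W *:%R psi psi_linear.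
by exists (HB.pack_for {linear lquot S -> W} psi L).
Qed.

Section TensorBilinear.
Variables (k : comNzRingType) (U V : lmodType k).
Implicit Types (u : U) (v : V).

Let relation_eq0 r : @bilinear_relation k U V r -> lclass (@bilinear_relation k U V) r = 0.
Proof.
move=> rS; rewrite -(linear0 (lclass (@bilinear_relation k U V))).
by apply/lclass_eqP; rewrite subr0; apply/asboolP => W _; exact.
Qed.

Lemma tensDl u u' v : tens (u + u') v = tens u v + tens u' v.
Proof.
apply/eqP; rewrite -subr_eq0 opprD addrA /tens -!linearB; apply/eqP.
by apply: relation_eq0; left; exists u, u', v.
Qed.

Lemma tensDr u v v' : tens u (v + v') = tens u v + tens u v'.
Proof.
apply/eqP; rewrite -subr_eq0 opprD addrA /tens -!linearB; apply/eqP.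
by apply: relation_eq0; right; left; exists u, v, v'.
Qed.

Lemma tensZl a u v : tens (a *: u) v = a *: tens u v.
Proof.
apply/eqP; rewrite -subr_eq0 /tens -linearZ -linearB; apply/eqP.
by apply: relation_eq0; right; right; left; exists a, u, v.
Qed.

Lemma tensZr a u v : tens u (a *: v) = a *: tens u v.
Proof.
apply/eqP; rewrite -subr_eq0 /tens -linearZ -linearB; apply/eqP.
by apply: relation_eq0; right; right; right; exists a, u, v.
Qed.

Lemma tens0l v : tens 0 v = 0 :> tensor U V.
Proof. by rewrite -(scale0r 0) tensZl scale0r. Qed.

Lemma tens0r u : tens u 0 = 0 :> tensor U V.
Proof. by rewrite -(scale0r 0) tensZr scale0r. Qed.

Lemma tens_suml (I : finType) (P : pred I) (F : I -> U) v :
  tens (\sum_(i | P i) F i) v = \sum_(i | P i) tens (F i) v.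
Proof.
by apply: (big_morph (fun u => tens u v)) => [u u'|]; rewrite ?tensDl ?tens0l.
Qed.

Lemma tens_sumr (I : finType) (P : pred I) (F : I -> V) u :
  tens u (\sum_(i | P i) F i) = \sum_(i | P i) tens u (F i).
Proof. by apply: (big_morph (tens u)) => [v v'|]; rewrite ?tensDr ?tens0r. Qed.

End TensorBilinear.

Lemma fglift_sumE (k : comNzRingType) (K : choiceType) (M : lmodType k)
    (f : K -> M) (z : {freeg K / k}) :
  fglift f z = \sum_(x <- dom z) coeff x z *: f x.
Proof.
pose L := GRing.isLinear.Build k _ M *:%R _ (fglift_linear f).
pose F : {linear {freeg K / k} -> M} := HB.pack_for {linear _ -> M} (fglift f) L.
rewrite -{1}(freeg_sumE z) (_ : fglift f = F) // linear_sum.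
by apply: eq_bigr => x _; rewrite /F /= liftU.
Qed.

Lemma fglift_sum (k : comNzRingType) (K I : choiceType) (M : lmodType k)
    (f : K -> M) (r : seq I) (F : I -> {freeg K / k}) :
  fglift f (\sum_(x <- r) F x) = \sum_(x <- r) fglift f (F x).
Proof.
pose L := GRing.isLinear.Build k _ M *:%R _ (fglift_linear f).
pose G : {linear {freeg K / k} -> M} := HB.pack_for {linear _ -> M} (fglift f) L.
by rewrite (_ : fglift f = G) // linear_sum.
Qed.

Lemma fglift_Z (k : comNzRingType) (K : choiceType) (M : lmodType k)
    (f : K -> M) a z : fglift f (a *: z) = a *: fglift f z.
Proof.
pose L := GRing.isLinear.Build k _ M *:%R _ (fglift_linear f).
pose G : {linear {freeg K / k} -> M} := HB.pack_for {linear _ -> M} (fglift f) L.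
by rewrite (_ : fglift f = G) // linearZ.
Qed.

(** * Homogeneous cochains *)

(** Homogeneous tuples are functions on [nat] of which only an initial segment
    matters, so that omitting the vertex [q] is precomposition with [bump q]
    and no change of type is needed. *)
Definition face_at (W : Type) (v : nat -> W) (q : nat) : nat -> W :=
  fun j => v (bump q j).

Definition depends_on_first (W M : Type) (n : nat) (T : (nat -> W) -> M) :=
  forall v w, (forall j, (j < n)%N -> v j = w j) -> T v = T w.

Section Coboundary.
Variables (k : comNzRingType) (M : lmodType k).

Definition coboundary (W : Type) (n : nat) (T : (nat -> W) -> M) (v : nat -> W) : M :=
  \sum_(q < n.+1) (-1) ^+ q *: T (face_at v q).

(** The tuples [a u_0, ..., a u_q, x u_q, x u_(q+1), ...] triangulate the prism
    that joins the simplex [a \o u] to the simplex [x \o u]. *)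
Definition prism_tuple (V W : Type) (a x : V -> W) (u : nat -> V) (q : nat) : nat -> W :=
  fun j => if (j <= q)%N then a (u j) else x (u j.-1).

Definition prism (V W : Type) (a x : V -> W) (n : nat)
    (T : (nat -> W) -> M) (u : nat -> V) : M :=
  \sum_(q < n) (-1) ^+ q *: T (prism_tuple a x u q).

Lemma prism_face_lt (V W : Type) (a x : V -> W) (u : nat -> V) (q l : nat) :
  (l <= q)%N ->
  face_at (prism_tuple a x u q.+1) l = prism_tuple a x (face_at u l) q.
Proof.
move=> lq; apply/funext => j; rewrite /face_at /prism_tuple /bump.
case: (leqP l j) => lj; last first.
  have -> : ((0 + j <= q.+1) = true)%N by lia.
  by have -> : ((j <= q) = true)%N by lia.
rewrite add1n ltnS; case: (leqP j q) => // jq.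
by congr (x (u _)); lia.
Qed.

Lemma prism_face_gt (V W : Type) (a x : V -> W) (u : nat -> V) (q l : nat) :
  (q < l)%N ->
  face_at (prism_tuple a x u q) l.+1 = prism_tuple a x (face_at u l) q.
Proof.
move=> ql; apply/funext => j; rewrite /face_at /prism_tuple /bump.
case: (leqP j q) => jq.
  have -> : (l < j)%N = false by lia.
  have -> : (l <= j)%N = false by lia.
  by rewrite !add0n jq.
have -> : (((l < j) + j <= q) = false)%N by lia.
by congr (x (u _)); lia.
Qed.

Definition mixed_tuple (V W : Type) (a x : V -> W) (u : nat -> V) (q : nat) : nat -> W :=
  fun j => if (j < q)%N then a (u j) else x (u j).

Lemma prism_face_eq (V W : Type) (a x : V -> W) (u : nat -> V) (q : nat) :
  face_at (prism_tuple a x u q) q = mixed_tuple a x u q.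
Proof.
apply/funext => j; rewrite /face_at /prism_tuple /mixed_tuple /bump.
case: (leqP q j) => jq.
  by have -> : ((1 + j <= q) = false)%N by lia.
by have -> : ((0 + j <= q) = true)%N by lia.
Qed.

Lemma prism_face_eqS (V W : Type) (a x : V -> W) (u : nat -> V) (q : nat) :
  face_at (prism_tuple a x u q) q.+1 = mixed_tuple a x u q.+1.
Proof.
apply/funext => j; rewrite /face_at /prism_tuple /mixed_tuple /bump ltnS.
case: (leqP j q) => jq.
  by rewrite add0n jq.
have -> : ((true + j <= q) = false)%N by lia.
by [].
Qed.

(** The faces of the prism simplices cancel in pairs inside the prism, form the
    prism over the boundary, or are its two ends. *)
Lemma coboundary_prism (V W : Type) (a x : V -> W) (n : nat)
    (T : (nat -> W) -> M) (u : nat -> V) :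
  depends_on_first n.+1 T ->
  (forall v, coboundary n.+1 T v = 0) ->
  coboundary n (prism a x n T) u = T (x \o u) - T (a \o u).
Proof.
move=> Tn Tcocycle.
pose E q l := (-1) ^+ (q + l) *: T (prism_tuple a x (face_at u l) q).
(* Multiplied by [(-1) ^+ q], the boundary of the prism simplex [q] consists of
   two faces that cut the prism and of faces of the prisms over [face_at u l]. *)
have boundary (q : nat) : (q < n.+1)%N ->
    T (mixed_tuple a x u q) - T (mixed_tuple a x u q.+1) =
    \sum_(0 <= l < q) E q.-1 l + \sum_(q.+1 <= l < n.+1) E q l.
  move=> qn; have := Tcocycle (prism_tuple a x u q).
  rewrite /coboundary -(big_mkord xpredT
    (fun l => (-1) ^+ l *: T (face_at (prism_tuple a x u q) l))).
  move=> /(congr1 (fun m => (-1) ^+ q *: m)); rewrite scaler0 scaler_sumr.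
  rewrite (@big_cat_nat _ _ _ q) //=; last by lia.
  rewrite [X in _ + X]big_ltn; last by lia.
  rewrite [X in _ + (_ + X)]big_ltn; last by lia.
  rewrite prism_face_eq prism_face_eqS !scalerA -!exprD addnn addnS addnn.
  have sign_double : (-1) ^+ q.*2 = 1 :> k by rewrite -signr_odd odd_double.
  rewrite exprS sign_double mulr1 scale1r scaleN1r.
  rewrite big_add1 /= => /eqP; rewrite addrCA [X in _ + X]addrCA.
  rewrite addrA addr_eq0 => /eqP ->.
  rewrite opprD -!sumrN; congr (_ + _); apply: eq_big_nat => l /andP[l1 l2].
    rewrite -{2}(prednK (leq_ltn_trans (leq0n l) l2)) prism_face_lt; last by lia.
    rewrite /E scalerA -exprD -[in LHS](prednK (leq_ltn_trans (leq0n l) l2)).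
    by rewrite addSn exprS mulN1r scaleNr opprK.
  rewrite prism_face_gt // scalerA -exprD addnS exprS mulN1r scaleNr.
  by rewrite opprK.
have cut_first : mixed_tuple a x u 0 = x \o u by apply/funext.
have cut_last : T (mixed_tuple a x u n.+1) = T (a \o u).
  by apply: Tn => j jn; rewrite /mixed_tuple jn.
have := telescope_sumr (fun q => T (mixed_tuple a x u q)) (leq0n n.+1).
rewrite cut_last cut_first => /(congr1 -%R); rewrite opprB => <-.
rewrite -sumrN (eq_big_nat _ _ (F2 := fun q =>
  \sum_(0 <= l < q) E q.-1 l + \sum_(q.+1 <= l < n.+1) E q l)); last first.
  by move=> q /andP[_ qn]; rewrite opprB boundary.
rewrite big_split /= [X in X + _]big_nat_recl // big_geq // add0r.
rewrite [X in _ + X]big_nat_recr //= [X in _ + (_ + X)]big_geq // addr0.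
rewrite -big_split /=.
transitivity (\sum_(0 <= q < n) \sum_(0 <= l < n.+1) E q l); last first.
  apply: eq_big_nat => q /andP[_ qn].
  by rewrite (@big_cat_nat _ _ _ q.+1) //= ltnW.
rewrite exchange_big_nat /= big_mkord; apply: eq_bigr => l _.
rewrite scaler_sumr -(big_mkord xpredT
  (fun q => (-1) ^+ l *: ((-1) ^+ q *: T (prism_tuple a x (face_at u l) q)))).
by apply: eq_bigr => q _; rewrite /E scalerA -exprD addnC.
Qed.

Lemma prism_first (V W : Type) (a x : V -> W) (n : nat) (T : (nat -> W) -> M) :
  depends_on_first n.+1 T -> depends_on_first n (prism a x n T).
Proof.
move=> Tn u w uw; apply: eq_bigr => q _; congr (_ *: _); apply: Tn => j jn.
have qn := ltn_ord q; rewrite /prism_tuple; case: leqP => jq; first by rewrite uw //; lia.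
by rewrite uw //; lia.
Qed.

End Coboundary.

(** * Homogeneous cochains on the bar complex *)

Section Bar.
Variables (G : groupType) (k : comNzRingType) (chi : G -> k) (M : lmodType k).

Definition vertex (n : nat) (g : n.-tuple G) (j : nat) : G :=
  (\prod_(h <- take j (rev g)) h)%g.

Lemma vertexS n (g : n.-tuple G) (j : nat) : (j < n)%N ->
  vertex g j.+1 = (vertex g j * nth 1 g (n - j.+1))%g.
Proof.
move=> jn; rewrite /vertex (take_nth 1%g) ?size_rev ?size_tuple //.
by rewrite -cats1 big_cat big_seq1 nth_rev ?size_tuple.
Qed.

Lemma vertex0 n (g : n.-tuple G) : vertex g 0 = 1%g.
Proof. by rewrite /vertex take0 big_nil. Qed.

(** Partial products absorb the merging of two entries, so a face only skips the
    vertex [n + 1 - p]. Skipping the initial vertex [1] leaves a tuple that has to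
    be translated back, which is what the twist in the bar complex accounts
    for. *)
Lemma vertex_face n (g : n.+1.-tuple G) (p : 'I_n.+2) j : (j < n.+1)%N ->
  vertex (face g p) j =
  ((if p == ord_max then (tnth g ord_max)^-1 else 1) *
    face_at (vertex g) (n.+1 - p) j)%g.
Proof.
have pn := ltn_ord p.
have top : (p == ord_max) = (p == n.+1 :> nat) by rewrite -val_eqE.
have last_entry : tnth g ord_max = nth 1%g g n by rewrite (tnth_nth 1%g).
rewrite top last_entry /face_at; elim: j => [|j IH] jn.
  rewrite vertex0 /bump; case: eqP => pn1.
    rewrite pn1 subnn /= vertexS // vertex0 mul1g subn1 /=.
    by rewrite mulVg.
  have -> : (n.+1 - p <= 0 = false)%N by lia.
  by rewrite vertex0 mulg1.
rewrite vertexS // IH; last by lia.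
rewrite -mulgA; congr (_ * _)%g.
have -> : nth 1%g (face g p) (n - j.+1) = (
  if ((n - j.+1).+1 < p)%N then nth 1 g (n - j.+1)
          else if ((n - j.+1).+1 == p)%N then nth 1 g (n - j.+1).+1 * nth 1 g (n - j.+1)
          else nth 1 g (n - j.+1).+1)%g.
  have jn' : (n - j.+1 < n)%N by lia.
  by rewrite -[(n - j.+1)%N]/(val (Ordinal jn')) -tnth_nth tnth_mktuple.
rewrite /bump; case: (ltnP (n - j.+1).+1 p) => lp.
  have -> : (n.+1 - p <= j)%N by lia.
  have -> : (n.+1 - p <= j.+1)%N by lia.
  by rewrite [in RHS]vertexS ?add1n; [congr (_ * nth _ _ _)%g; lia | lia].
case: eqP => [pe|pne].
  have -> : (n.+1 - p <= j = false)%N by lia.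
  have -> : (n.+1 - p <= j.+1)%N by lia.
  rewrite add0n add1n vertexS; last by lia.
  rewrite vertexS; last by lia.
  by rewrite mulgA; congr (_ * nth _ _ _ * nth _ _ _)%g; lia.
have -> : (n.+1 - p <= j = false)%N by lia.
have -> : (n.+1 - p <= j.+1 = false)%N by lia.
by rewrite !add0n vertexS; [congr (_ * nth _ _ _)%g; lia | lia].
Qed.

Definition equivariant (T : (nat -> G) -> M) :=
  forall h u, T (fun j => (h * u j)%g) = chi h *: T u.

Lemma prism_equivariant (W : Type) (act : G -> W -> W) (a x : G -> W) n
    (T : (nat -> W) -> M) :
  (forall h v, T (act h \o v) = chi h *: T v) ->
  (forall h g, a (h * g)%g = act h (a g)) -> (forall h g, x (h * g)%g = act h (x g)) ->
  equivariant (prism a x n T).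
Proof.
move=> Tact aact xact h u; rewrite /prism scaler_sumr; apply: eq_bigr => q _.
rewrite scalerA mulrC -scalerA -Tact; congr (_ *: T _).
by apply/funext => j; rewrite /prism_tuple /=; case: ifP.
Qed.

(** On an equivariant cochain the translation in the last face produces a second
    factor [chi], which cancels the twist. The remaining sign comes from the
    opposite numbering of faces and vertices. *)
Lemma fglift_bar_boundary n (T : (nat -> G) -> M) (w : bar_chain G k n.+1) :
  (forall h, chi h * chi h = 1) -> depends_on_first n.+1 T -> equivariant T ->
  fglift (fun g => T (vertex g)) (bar_boundary chi w) =
  (-1) ^+ n.+1 *: fglift (fun g => coboundary n.+1 T (vertex g)) w.
Proof.
move=> chi2 Tn Tequiv; rewrite /bar_boundary (fglift_sumE _ w) fglift_sum.
rewrite fglift_sumE scaler_sumr; apply: eq_bigr => g _.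
rewrite fglift_Z scalerA mulrC -scalerA; congr (_ *: _).
rewrite fglift_sum /coboundary scaler_sumr (reindex_inj rev_ord_inj) /=.
apply: eq_bigr => q _; rewrite liftU /face_coef.
have qn := ltn_ord q.
have -> : T (vertex (face g (rev_ord q))) =
    (if rev_ord q == ord_max then chi (tnth g ord_max)^-1%g else 1)
      *: T (face_at (vertex g) q).
  rewrite (Tn _ (fun j => (if rev_ord q == ord_max then (tnth g ord_max)^-1 else 1) *
            face_at (vertex g) q j)%g); last first.
    move=> j jn; rewrite vertex_face //.
    by congr (_ * face_at _ _ _)%g; rewrite /=; lia.
  case: ifP => _; first exact: Tequiv.
  by rewrite scale1r; apply: Tn => j _; rewrite mul1g.
rewrite !scalerA -mulrA; congr (_ *: _).
have -> : (-1) ^+ rev_ord q = (-1) ^+ n.+1 * (-1) ^+ q :> k.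
  have same_parity : odd (rev_ord q) = odd (n.+1 + q).
    by rewrite [val (rev_ord q)]/= subSS oddB ?oddD; last exact: qn.
  by rewrite -exprD -signr_odd same_parity signr_odd.
by case: ifP => _; rewrite ?chi2 !mulr1.
Qed.

End Bar.

(** * Additivity of scissors classes *)

Section ScissorsClass.
Variables (R : realType) (n : nat) (X : set 'cV[R]_n.+1).
Variables (isom : set ('cV[R]_n.+1 -> 'cV[R]_n.+1)) (N : set (set 'cV[R]_n.+1)).
Local Notation cls := (scissors_class X isom N).
Implicit Types (A B : set 'cV[R]_n.+1).

Lemma scissors_classE (P : polytope X) :
  cls P = lclass (@scissors_relation _ _ X isom N) << P >>.
Proof. by rewrite /scissors_class valK. Qed.

Let relation_eq0 r : @scissors_relation _ _ X isom N r ->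
  lclass (@scissors_relation _ _ X isom N) r = 0.
Proof.
move=> rS; rewrite -(linear0 (lclass (@scissors_relation _ _ X isom N))).
by apply/lclass_eqP; rewrite subr0; apply/asboolP => W _; exact.
Qed.

Lemma polytope_mk A : is_polytope X A -> exists P : polytope X, P = A :> set _.
Proof. by move=> pA; exists (Polytope (asboolT pA)). Qed.

Lemma simplex_polytope A : is_simplex X A -> is_polytope X A.
Proof.
move=> sA; exists 1%N, (fun=> A); split=> //.
by apply/seteqP; split=> v => [Av|[]] //; exists ord0.
Qed.

Lemma polytope0 : is_polytope X set0.
Proof.
exists 0%N, (fun=> set0); split; first by case.
by apply/seteqP; split=> v // [[]].
Qed.

Lemma polytopeU A B : is_polytope X A -> is_polytope X B -> is_polytope X (A `|` B).
Proof.
move=> [p [F [sF ->]]] [q [F' [sF' ->]]].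
exists (p + q)%N, (fun j => match fintype.split j with inl i => F i | inr i => F' i end).
split=> [j|]; first by case: (fintype.split j).
apply/seteqP; split=> v.
  case=> [] [i _ Fi]; first by exists (lshift q i); rewrite // (unsplitK (inl i)).
  by exists (rshift p i); rewrite // (unsplitK (inr i)).
by case=> j _; case: (fintype.split j) => i Fi; [left | right]; exists i.
Qed.

Lemma thinS A B : A `<=` B -> is_thin B -> is_thin A.
Proof. by move=> AB [s [sd sB]]; exists s; split=> // v /AB; exact: sB. Qed.

Lemma thin0 : @is_thin R n set0.
Proof. by exists [::]. Qed.

Lemma thinU A B : is_thin A -> is_thin B -> is_thin (A `|` B).
Proof.
move=> [s [sd sA]] [t [td tB]]; exists (s ++ t); split=> [W|v].
  by rewrite mem_cat => /orP[/sd|/td].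
by case=> [/sA|/tB] [W Wm vW]; exists W; rewrite // mem_cat Wm ?orbT.
Qed.

Lemma scissors_classU A B : is_polytope X A -> is_polytope X B ->
  is_thin (A `&` B) -> cls (A `|` B) = cls A + cls B.
Proof.
move=> pA pB; have [U UE] := polytope_mk (polytopeU pA pB).
have [P PE] := polytope_mk pA; have [Q QE] := polytope_mk pB.
rewrite -UE -PE -QE !scissors_classE => thinPQ.
apply/eqP; rewrite -subr_eq0 -linearD -linearB; apply/eqP; apply: relation_eq0.
by left; exists P, Q, U; split=> //; rewrite UE PE QE.
Qed.

Lemma scissors_class_isom g A : isom g -> is_polytope X A ->
  is_polytope X (g @` A) -> cls (g @` A) = cls A.
Proof.
move=> ig /polytope_mk[P PE] /polytope_mk[Q QE].
rewrite -QE -PE !scissors_classE; apply/esym/eqP.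
rewrite -subr_eq0 -linearB; apply/eqP/relation_eq0.
by right; left; exists P, Q, g; rewrite QE PE.
Qed.

Lemma scissors_class_eq0 A : is_polytope X A -> N A -> cls A = 0.
Proof.
move=> /polytope_mk[P PE] NA; rewrite -PE scissors_classE.
by apply: relation_eq0; right; right; exists P; rewrite ?PE.
Qed.

Lemma scissors_class0 : cls set0 = 0.
Proof.
have := scissors_classU polytope0 polytope0 (thinS (@subIsetr _ _ _) thin0).
by rewrite setU0 => /eqP; rewrite -subr_eq subrr eq_sym => /eqP.
Qed.

Lemma scissors_class_bigU (I : eqType) (s : seq I) (F : I -> set 'cV[R]_n.+1) :
  uniq s -> (forall k, k \in s -> is_polytope X (F k)) ->
  (forall k l, k \in s -> l \in s -> k != l -> is_thin (F k `&` F l)) ->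
  is_polytope X (\big[setU/set0]_(k <- s) F k) /\
  cls (\big[setU/set0]_(k <- s) F k) = \sum_(k <- s) cls (F k).
Proof.
elim: s => [|k s IH] /=.
  by rewrite !big_nil scissors_class0; split=> //; exact: polytope0.
move=> /andP[ks us] pF thinF.
have [||ps clss] := IH us.
- by move=> l ls; apply: pF; rewrite in_cons ls orbT.
- by move=> l l' ls ls'; apply: thinF; rewrite in_cons ?ls ?ls' orbT.
have pk : is_polytope X (F k) by apply: pF; rewrite in_cons eqxx.
rewrite !big_cons; split; first exact: polytopeU.
rewrite scissors_classU ?clss //.
have {}thinF l : l \in s -> is_thin (F k `&` F l).
  move=> ls; apply: thinF; rewrite ?in_cons ?eqxx ?ls ?orbT //.
  by apply: contraNneq ks => ->.
elim: s {IH ks us pF ps clss} thinF => [|l s IH] thinF.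
  by rewrite big_nil setI0; exact: thin0.
rewrite big_cons setIUr; apply: thinU; first by apply: thinF; rewrite in_cons eqxx.
by apply: IH => l' l's; apply: thinF; rewrite in_cons l's orbT.
Qed.

End ScissorsClass.

(** * Cones over independent columns *)

Section Cones.
Variables (R : realType) (n : nat).

Definition independent m (I : {set 'I_m}) (V : 'M[R]_(n.+1, m)) :=
  forall c : 'I_m -> R, \sum_(k in I) c k *: col k V = 0 ->
  forall k, k \in I -> c k = 0.

Lemma mulmx_sum_col p q (A : 'M[R]_(p, q)) (y : 'cV[R]_q) :
  A *m y = \sum_j y j 0 *: col j A.
Proof.
apply/colP => i; rewrite !mxE summxE; apply: eq_bigr => j _.
by rewrite !mxE mulrC.
Qed.

Lemma col_mul p q r (A : 'M[R]_(p, q)) (B : 'M[R]_(q, r)) j :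
  col j (A *m B) = A *m col j B.
Proof. by apply/colP => i; rewrite !mxE; apply: eq_bigr => k _; rewrite !mxE. Qed.

Lemma col_colsub p q r (f : 'I_q -> 'I_r) (A : 'M[R]_(p, r)) j :
  col j (colsub f A) = col (f j) A.
Proof. by apply/colP => i; rewrite !mxE. Qed.

Definition enumerates m p (e : 'I_p -> 'I_m) (I : {set 'I_m}) :=
  injective e /\ I = [set e j | j : 'I_p]%SET.

Lemma enumerates_sum m p (e : 'I_p -> 'I_m) I (M : nmodType) (F : 'I_m -> M) :
  enumerates e I -> \sum_(l in I) F l = \sum_j F (e j).
Proof.
move=> [einj ->]; rewrite big_imset /=; last by move=> j j' _ _; exact: einj.
by apply: eq_bigl => j; rewrite inE.
Qed.

Lemma enumerates_in m p (e : 'I_p -> 'I_m) I j : enumerates e I -> e j \in I.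
Proof. by move=> [_ ->]; apply: imset_f. Qed.

Lemma exists_enumeration m p (I : {set 'I_m}) k : #|I| = p.+1 -> k \in I ->
  exists2 e : 'I_p.+1 -> 'I_m, enumerates e I & e ord_max = k.
Proof.
move=> cardI kI; pose r := enum_rank_in kI.
pose s := tperm (cast_ord cardI (r k)) ord_max.
exists (fun j => enum_val (cast_ord (esym cardI) (s j))); last first.
  by rewrite tpermR cast_ordK enum_rankK_in.
split; first by move=> j j' /enum_val_inj/cast_ord_inj/perm_inj.
apply/finset.setP => l; apply/idP/imsetP => [lI|[j _ ->]]; last exact: enum_valP.
by exists (s (cast_ord cardI (r l))); rewrite // tpermK cast_ordK enum_rankK_in.
Qed.

Lemma cone_colsub m p (e : 'I_p -> 'I_m) I (V : 'M[R]_(n.+1, m)) :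
  enumerates e I -> cone I V = cone finset.setT (colsub e V).
Proof.
move=> eI; have [einj _] := eI; apply/seteqP; split=> v [c c0 ->].
  exists (c \o e) => [j|]; first exact: c0.
  rewrite (enumerates_sum _ eI); apply: eq_big => j; first by rewrite inE.
  by rewrite col_colsub.
exists (fun l => \sum_(j | e j == l) c j) => [l|]; first exact: sumr_ge0.
rewrite (enumerates_sum _ eI); apply: eq_big => j; first by rewrite inE.
by rewrite (big_pred1 j) ?col_colsub // => j'; exact: inj_eq.
Qed.

Lemma unitmx_kernel p (b : 'M[R]_p) :
  (forall y : 'cV_p, b *m y = 0 -> y = 0) -> b \in unitmx.
Proof.
move=> kb; rewrite unitmxE unitfE -det_tr; apply/negP => /det0P[v v0 vb].
move: v0; rewrite -(inj_eq trmx_inj) trmx0 => /eqP; apply; apply: kb.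
by rewrite -[b]trmxK -trmx_mul vb trmx0.
Qed.

Lemma colsub_mulK p q (e : 'I_p -> 'I_q) (Y : 'M[R]_(n.+1, q)) (I : {set 'I_q})
    (c : 'cV[R]_p) : enumerates e I -> independent I Y -> colsub e Y *m c = 0 -> c = 0.
Proof.
move=> eI indepY; have [einj _] := eI; rewrite mulmx_sum_col => Yc0.
have cI : forall l, l \in I -> \sum_(j | e j == l) c j 0 = 0.
  apply: indepY; rewrite (enumerates_sum _ eI) -[RHS]Yc0; apply: eq_bigr => j _.
  by rewrite (big_pred1 j) ?col_colsub // => j'; exact: inj_eq.
apply/colP => j; rewrite mxE -(cI (e j) (enumerates_in j eI)).
by rewrite (big_pred1 j) // => j'; exact: inj_eq.
Qed.

Lemma independent_unitmx m (e : 'I_n.+1 -> 'I_m) I (V : 'M[R]_(n.+1, m)) :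
  enumerates e I -> independent I V -> colsub e V \in unitmx.
Proof. by move=> eI indepI; apply: unitmx_kernel => y; exact: colsub_mulK eI indepI. Qed.

Lemma unitmx_independent (b : 'M[R]_n.+1) :
  b \in unitmx -> independent [set: 'I_n.+1]%SET b.
Proof.
move=> bu c bc k _; have /(congr1 (mulmx (invmx b))) : b *m (\col_j c j) = 0.
  by rewrite mulmx_sum_col -[RHS]bc; apply: eq_big => j; rewrite ?inE ?mxE.
by rewrite mulKmx // mulmx0 => /colP/(_ k); rewrite !mxE.
Qed.

Lemma independent_scale m (I : {set 'I_m}) (V V' : 'M[R]_(n.+1, m)) (r : 'I_m -> R) :
  (forall k, r k != 0) -> (forall k, k \in I -> col k V' = r k *: col k V) ->
  independent I V -> independent I V'.
Proof.
move=> r0 VV' indep c cV' k kI.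
have crV : \sum_(j in I) (c j * r j) *: col j V = 0.
  by rewrite -[RHS]cV'; apply: eq_bigr => j jI; rewrite VV' // scalerA.
have /eqP := indep _ crV k kI.
by rewrite mulf_eq0 (negPf (r0 k)) orbF => /eqP.
Qed.

Section Facet.
Variables (m : nat) (I : {set 'I_m}) (V : 'M[R]_(n.+1, m)).
Hypotheses (cardI : #|I| = n.+1) (indepI : independent I V).

(** The hyperplane is cut out by the coordinate of [k]. *)
Lemma cone_facet_thin k : k \in I -> is_thin (cone (I :\ k) V).
Proof.
move=> kI; have [e eI ek] := exists_enumeration cardI kI.
set b := colsub e V; have bu : b \in unitmx by exact: independent_unitmx eI indepI.
have facet v : cone (I :\ k) V v -> (invmx b *m v) ord_max 0 = 0.
  move=> [c _ ->]; pose y : 'cV_n.+1 := \col_j (if e j == k then 0 else c (e j)).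
  have -> : \sum_(l in I :\ k) c l *: col l V = b *m y.
    transitivity (\sum_(l in I) (if l == k then 0 else c l) *: col l V).
      rewrite [RHS](bigD1 k) //= eqxx scale0r add0r; apply: eq_big => l.
        by rewrite !inE andbC.
      by rewrite !inE => /andP[/negPf->].
    rewrite (enumerates_sum _ eI) mulmx_sum_col; apply: eq_bigr => j _.
    by rewrite col_colsub mxE.
  by rewrite mulKmx // mxE ek eqxx.
pose f : 'Hom('cV[R]_n.+1, 'cV[R]_1) :=
  linfun (mulmx (row ord_max (invmx b))).
exists [:: lker f]; split=> [W|v /facet v0]; last first.
  exists (lker f); rewrite ?mem_seq1 // memv_ker lfunE /= -row_mul.
  by apply/eqP/colP => i; rewrite (ord1 i) [LHS]mxE v0 mxE.
rewrite mem_seq1 => /eqP ->.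
have fonto : limg f = fullv.
  apply/eqP; rewrite eqEsubv subvf /=; apply/subvP => w _.
  apply/memv_imgP; exists (w 0 0 *: col ord_max b); rewrite ?memvf //.
  rewrite linearZ /= lfunE /= -row_mul -col_mul mulVmx //.
  by apply/colP => i; rewrite (ord1 i) !mxE eqxx mulr1.
have := limg_ker_dim f fullv; rewrite capfv fonto !dimvf /dim /= muln1 muln1 addn1.
by move=> [].
Qed.

End Facet.

End Cones.

(** * Flips *)

Section Flip.
Variables (R : realType) (n : nat) (X : set 'cV[R]_n.+1).
Variables (isom : set ('cV[R]_n.+1 -> 'cV[R]_n.+1)) (N : set (set 'cV[R]_n.+1)).
Local Notation cls := (scissors_class X isom N).

Definition meets_ray (v : 'cV[R]_n.+1) := exists2 r : R, 0 < r & X (r *: v).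

Lemma cone_scale m (I : {set 'I_m}) (V V' : 'M[R]_(n.+1, m)) (r : 'I_m -> R) :
  (forall k, 0 < r k) -> (forall k, k \in I -> col k V' = r k *: col k V) ->
  cone I V' = cone I V.
Proof.
move=> r0 VV'; apply/seteqP; split=> v [c c0 ->].
  exists (fun k => c k * r k) => [k|]; first by rewrite mulr_ge0 // ltW.
  by apply: eq_bigr => k kI; rewrite VV' // scalerA.
exists (fun k => c k / r k) => [k|]; first by rewrite divr_ge0 // ltW.
by apply: eq_bigr => k kI; rewrite VV' // scalerA divfK // gt_eqF.
Qed.

Lemma cone_section_scale m (I : {set 'I_m}) (V V' : 'M[R]_(n.+1, m)) (r : 'I_m -> R) :
  (forall k, 0 < r k) -> (forall k, k \in I -> col k V' = r k *: col k V) ->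
  cone_section X I V' = cone_section X I V.
Proof. by move=> r0 rV; rewrite /cone_section (cone_scale r0 rV). Qed.

Lemma scale_cols_unit (b : 'M[R]_n.+1) (r : 'I_n.+1 -> R) :
  b \in unitmx -> (forall j, r j != 0) -> \matrix_(i, j) (r j * b i j) \in unitmx.
Proof.
move=> bu r0.
have -> : \matrix_(i, j) (r j * b i j) = b *m diag_mx (\row_j r j).
  by apply/matrixP => i j; rewrite mul_mx_diag !mxE mulrC.
rewrite unitmx_mul bu /= unitmxE det_diag unitfE.
by apply/prodf_neq0 => j _; rewrite mxE.
Qed.

Lemma cone_section_simplex m (I : {set 'I_m}) (V : 'M[R]_(n.+1, m)) :
  #|I| = n.+1 -> independent I V -> (forall k, k \in I -> meets_ray (col k V)) ->
  is_simplex X (cone_section X I V).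
Proof.
move=> cardI indepI rayV.
have [k kI] : exists k, k \in I by apply/set0Pn; rewrite -card_gt0 cardI.
have [e eI _] := exists_enumeration cardI kI.
set b := colsub e V; have bu : b \in unitmx by exact: independent_unitmx eI indepI.
have rayb j : exists r : R, 0 < r /\ X (r *: col j b).
  have [r r0 rX] := rayV (e j) (enumerates_in j eI).
  by exists r; rewrite /b col_colsub.
have [r rP] := choice rayb; have r0 j : 0 < r j by have [] := rP j.
pose b' := \matrix_(i, j) (r j * b i j).
have colb' j : col j b' = r j *: col j b by apply/colP => i; rewrite !mxE.
exists b'; split.
- by apply: scale_cols_unit => // j; rewrite gt_eqF.
- by move=> j; rewrite colb'; have [] := rP j.
- rewrite /simplex /cone_section (cone_colsub _ eI).
  by rewrite (cone_scale (V := b) (V' := b') r0).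
Qed.

Lemma setD1_notin_id m (I : {set 'I_m}) k : k \notin I -> I :\ k = I.
Proof.
by move=> kI; apply/finset.setP => l; rewrite !inE; case: eqVneq => // ->;
  rewrite (negPf kI).
Qed.

Lemma sum_setD1_zero m (I : {set 'I_m}) k (c : 'I_m -> R) (V : 'M[R]_(n.+1, m)) :
  c k = 0 -> \sum_(l in I :\ k) c l *: col l V = \sum_(l in I) c l *: col l V.
Proof.
move=> ck; have [kI|kI] := boolP (k \in I); last by rewrite setD1_notin_id.
rewrite [RHS](bigD1 k) //= ck scale0r add0r; apply: eq_bigl => l.
by rewrite !inE andbC.
Qed.

(** A point of [cone K V] can be moved along the relation [lam] until one of the
    coordinates with [lam k > 0] vanishes, and there is only one way to do so:
    the cones that omit a positive vertex dissect [cone K V]. *)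
Lemma dissect_by_positive m (V : 'M[R]_(n.+1, m)) (K : {set 'I_m}) (lam : 'I_m -> R) :
  #|K| = n.+2 -> \sum_(k in K) lam k *: col k V = 0 ->
  (forall k, k \in K -> meets_ray (col k V)) ->
  (forall k, k \in K -> lam k != 0 -> independent (K :\ k) V) ->
  (exists2 k, k \in K & 0 < lam k) ->
  cls (cone_section X K V) =
    \sum_(k in K | 0 < lam k) cls (cone_section X (K :\ k) V).
Proof.
move=> cardK lam0 rayV indepK [k1 k1K lamk1].
have cardD k : k \in K -> #|K :\ k| = n.+1.
  by move=> kK; have := cardsD1 k K; rewrite kK cardK => -[].
have := @scissors_class_bigU R n X isom N _ (enum [pred k in K | 0 < lam k])
  (fun k => cone_section X (K :\ k) V) (enum_uniq _).
rewrite [\sum_(_ <- _) _]big_enum [\big[setU/set0]_(_ <- _) _]big_enum /=.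
move=> -[k|k l|_ <-].
- rewrite mem_enum inE => /andP[kK lamk].
  apply/simplex_polytope/cone_section_simplex; first exact: cardD.
    by apply: indepK => //; rewrite gt_eqF.
  by move=> l; rewrite !inE => /andP[_]; exact: rayV.
- rewrite !mem_enum !inE => /andP[kK lamk] /andP[lK laml] kl.
  have indepk : independent (K :\ k) V by apply: indepK; rewrite ?gt_eqF.
  have lKk : l \in K :\ k by rewrite !inE eq_sym kl.
  apply: thinS (cone_facet_thin (cardD k kK) indepk lKk).
  move=> v [[_ [c c0 vc]] [_ [c' c'0 vc']]].
  (* The values of [c] at [k] and of [c'] at [l] occur in no sum. *)
  pose C j := if j == k then 0 else c j; pose C' j := if j == l then 0 else c' j.
  have vC : v = \sum_(j in K) C j *: col j V.
    rewrite vc -(@sum_setD1_zero _ K k) ?/C ?eqxx //; apply: eq_bigr => j.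
    by rewrite !inE => /andP[/negPf->].
  have vC' : v = \sum_(j in K) C' j *: col j V.
    rewrite vc' -(@sum_setD1_zero _ K l) ?/C' ?eqxx //; apply: eq_bigr => j.
    by rewrite !inE => /andP[/negPf->].
  pose t := - C' k / lam k.
  pose mu j := C j - C' j - t * lam j.
  have muk : mu k = 0 by rewrite /mu /t {1}/C eqxx divfK ?gt_eqF // sub0r subrr.
  have mu0 : forall j, j \in K :\ k -> mu j = 0.
    apply: indepk; rewrite sum_setD1_zero //.
    under eq_bigr do rewrite !scalerBl -scalerA.
    by rewrite !sumrB -scaler_sumr lam0 scaler0 subr0 -vC -vC' subrr.
  have Cl : C l = 0.
    have /eqP := mu0 l lKk; rewrite /mu {1}/C' eqxx subr0 subr_eq0 => /eqP Clt.
    apply/eqP; rewrite eq_le; apply/andP; split; last first.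
      by rewrite /C; case: ifP.
    rewrite Clt /t mulNr mulNr oppr_le0 mulr_ge0 ?(ltW laml) // divr_ge0 ?(ltW lamk) //.
    by rewrite /C'; case: ifP.
  exists C => [j|]; first by rewrite /C; case: ifP.
  by rewrite !sum_setD1_zero // /C eqxx.
congr cls; apply/seteqP; split=> v.
- move=> [Xv [c c0 vc]]; rewrite -bigcup_seq_cond /=.
  have [k /andP[kK lamk] kmin] : exists2 k, (k \in K) && (0 < lam k) &
      forall j, (j \in K) && (0 < lam j) -> c k / lam k <= c j / lam j.
    have k1P : (k1 \in K) && (0 < lam k1) by rewrite k1K.
    by case: (@arg_minP _ _ _ k1 (fun k => (k \in K) && (0 < lam k))
      (fun k => c k / lam k) k1P) => k Pk kmin; exists k.
  pose t := c k / lam k; have t0 : 0 <= t by rewrite divr_ge0 // ltW.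
  exists k; first by rewrite /= mem_index_enum inE /= kK.
  split=> //; exists (fun j => if j \in K then c j - t * lam j else 0).
    move=> j; case: ifP => // jK; rewrite subr_ge0.
    have [lamj|lamj] := ltP 0 (lam j); last first.
      by apply: le_trans (c0 j); rewrite mulr_ge0_le0.
    by rewrite -ler_pdivlMr // kmin // jK.
  rewrite sum_setD1_zero ?kK ?divfK ?subrr ?gt_eqF //.
  under eq_bigr => j jK do rewrite jK scalerBl -scalerA.
  by rewrite sumrB -scaler_sumr lam0 scaler0 subr0.
- rewrite -bigcup_seq_cond => -[k /andP[_]]; rewrite inE => /andP[kK _] [Xv [c c0 vc]].
  split=> //; exists (fun j => if j == k then 0 else c j) => [j|]; first by case: ifP.
  rewrite -(@sum_setD1_zero _ K k) ?eqxx // vc; apply: eq_bigr => j.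
  by rewrite !inE => /andP[/negPf->].
Qed.

Lemma sgz_zhalf_gt0 (x : R) : 0 < x -> (sgz x)%:~R = 1 :> zhalf.
Proof. by move=> x0; rewrite gtr0_sgz. Qed.

Lemma sgz_zhalf_lt0 (x : R) : x < 0 -> (sgz x)%:~R = -1 :> zhalf.
Proof. by move=> x0; rewrite ltr0_sgz // mulrNz. Qed.

Lemma flip m (V : 'M[R]_(n.+1, m)) (K : {set 'I_m}) (lam : 'I_m -> R) :
  #|K| = n.+2 -> \sum_(k in K) lam k *: col k V = 0 ->
  (forall k, k \in K -> meets_ray (col k V)) ->
  (forall k, k \in K -> lam k != 0 -> independent (K :\ k) V) ->
  (exists2 k, k \in K & 0 < lam k) -> (exists2 k, k \in K & lam k < 0) ->
  \sum_(k in K) ((sgz (lam k))%:~R : zhalf) *: cls (cone_section X (K :\ k) V) = 0.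
Proof.
move=> cardK lam0 rayV indepK pos [kn knK lamkn].
have := dissect_by_positive cardK lam0 rayV indepK pos.
have := @dissect_by_positive _ V K (fun k => - lam k) cardK _ rayV.
move=> ->; [|by under eq_bigr do rewrite scaleNr; rewrite sumrN lam0 oppr0
  |by move=> k kK; rewrite oppr_eq0; exact: indepK
  |by exists kn; rewrite ?oppr_gt0].
under eq_bigl do rewrite oppr_gt0.
move=> flipE.
rewrite (bigID (fun k => 0 < lam k)) /= [X in X + _](eq_bigr
  (fun k => cls (cone_section X (K :\ k) V))); last first.
  by move=> k /andP[_ lamk]; rewrite sgz_zhalf_gt0 // scale1r.
rewrite -flipE [X in _ + X](bigID (fun k => lam k < 0)) /= [X in _ + (_ + X)]big1 ?addr0; last first.
  move=> k /andP[/andP[_]]; rewrite -!leNgt => lamk1 lamk2.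
  have -> : lam k = 0 by apply/eqP; rewrite eq_le lamk1.
  by rewrite sgz0 scale0r.
rewrite [X in _ + X](eq_bigr (fun k => - cls (cone_section X (K :\ k) V))); last first.
  by move=> k /andP[_ lamk]; rewrite sgz_zhalf_lt0 // scaleN1r.
rewrite [X in _ + X](eq_bigl (fun k => (k \in K) && (lam k < 0))).
  by rewrite sumrN subrr.
move=> k; rewrite -andbA; congr (_ && _).
by case: (ltP 0 (lam k)) => //= lamk; rewrite ltNge ltW.
Qed.

End Flip.

(** * Spherical classes modulo suspensions *)

Section Sphere.
Variables (R : realType) (n : nat).
Local Notation "''e_max'" := (@ord_max n).
Implicit Types (b c : 'M[R]_n.+1).

Definition dot (u v : 'cV[R]_n.+1) : R := (u^T *m v) 0 0.

Lemma dotE u v : dot u v = \sum_i u i 0 * v i 0.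
Proof. by rewrite /dot mxE; apply: eq_bigr => i _; rewrite mxE. Qed.

Lemma dot_gt0 v : v != 0 -> 0 < dot v v.
Proof.
move=> v0; rewrite dotE lt_def sumr_ge0 ?andbT => [|i _]; last by rewrite -expr2 sqr_ge0.
apply: contraNneq v0 => /psumr_eq0P vi; apply/eqP/colP => i; rewrite mxE.
by apply/eqP; rewrite -sqrf_eq0 expr2 vi // => j _; rewrite -expr2 sqr_ge0.
Qed.

Lemma dotZ r s u v : dot (r *: u) (s *: v) = r * s * dot u v.
Proof.
by rewrite !dotE mulr_sumr; apply: eq_bigr => i _; rewrite !mxE mulrACA.
Qed.

Lemma usphere_normalize v : v != 0 -> usphere R n ((Num.sqrt (dot v v))^-1 *: v).
Proof.
move=> v0; rewrite /usphere /= -/(dot _ _) dotZ -invfM -expr2 sqr_sqrtr ?ltW ?dot_gt0 //.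
by rewrite mulVf // gt_eqF // dot_gt0.
Qed.

Lemma usphere_meets_ray v : v != 0 -> meets_ray (usphere R n) v.
Proof.
move=> v0; exists (Num.sqrt (dot v v))^-1; last exact: usphere_normalize.
by rewrite invr_gt0 sqrtr_gt0 dot_gt0.
Qed.

Definition negate_last b : 'M[R]_n.+1 :=
  \matrix_(i, j) (if j == 'e_max then - b i j else b i j).

(** The last coordinate is free: the cone is unbounded in both directions along
    the line of the last column. *)
Definition lune b : set 'cV[R]_n.+1 :=
  [set v | exists2 a : 'I_n.+1 -> R, forall j, j != 'e_max -> 0 <= a j &
           v = \sum_j a j *: col j b].

Lemma col_negate_last b j :
  col j (negate_last b) = (if j == 'e_max then -1 else 1) *: col j b.
Proof.
by apply/colP => i; rewrite !mxE; case: ifP => _; rewrite ?mulN1r ?mul1r.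
Qed.

Lemma cone_setT b v :
  cone finset.setT b v <->
  exists2 a : 'I_n.+1 -> R, forall j, 0 <= a j & v = \sum_j a j *: col j b.
Proof.
by split=> -[a a0 ->]; exists a => //; apply: eq_bigl => j; rewrite inE.
Qed.

Lemma cone_negate_lastU b : cone finset.setT b `|` cone finset.setT (negate_last b) = lune b.
Proof.
apply/seteqP; split=> v.
  move=> [] /cone_setT[a a0 ->]; first by exists a.
  exists (fun j => a j * (if j == 'e_max then -1 else 1)) => [j /negPf->|].
    by rewrite mulr1.
  by apply: eq_bigr => j _; rewrite col_negate_last scalerA.
move=> [a a0 ->]; have [amax|amax] := leP 0 (a 'e_max).
  left; apply/cone_setT; exists a => // j.
  by have [->|/a0] := eqVneq j 'e_max.
right; apply/cone_setT; exists (fun j => a j * (if j == 'e_max then -1 else 1)).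
  move=> j; case: eqVneq => [->|/a0]; last by rewrite mulr1.
  by rewrite mulrN1 oppr_ge0 ltW.
apply: eq_bigr => j _; rewrite col_negate_last scalerA.
by case: eqVneq; rewrite ?mulrN1 ?mulr1 ?mulrN1 ?opprK.
Qed.

Lemma lune_subset b c (r mu : 'I_n.+1 -> R) :
  (forall j, 0 < r j) ->
  (forall j, col j c = r j *: col j b +
     (if j == 'e_max then 0 else mu j) *: col 'e_max b) ->
  lune c `<=` lune b.
Proof.
move=> r0 cb v [a a0 ->].
pose t := \sum_j a j * (if j == 'e_max then 0 else mu j).
exists (fun j => a j * r j + (if j == 'e_max then t else 0)).
  by move=> j jm; rewrite (negPf jm) addr0 mulr_ge0 ?a0 // ltW.
under [RHS]eq_bigr do rewrite scalerDl -scalerA.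
under [LHS]eq_bigr do rewrite cb scalerDr [X in _ + X]scalerA.
rewrite !big_split /= -scaler_suml -/t; congr (_ + _).
by rewrite [RHS](bigD1 'e_max) //= eqxx big1 ?addr0 // => j /negPf->; rewrite scale0r.
Qed.

(** The lune of [b] is the suspension of the projection of the other columns to
    the hyperplane orthogonal to the last one. *)
Lemma lune_suspension b : b \in unitmx ->
  suspension (usphere R n `&` lune b).
Proof.
move=> bu; pose l := col 'e_max b.
have indepb := unitmx_independent bu.
have col_neq0 (a : 'I_n.+1 -> R) j : a j != 0 -> \sum_j a j *: col j b != 0.
  move=> aj; apply/eqP => ab; case/eqP: aj; apply: (indepb a) => //.
  by rewrite -[RHS]ab; apply: eq_bigl => i; rewrite inE.
have l0 : l != 0.
  have := col_neq0 (fun j => (j == 'e_max)%:R) 'e_max.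
  rewrite eqxx oner_eq0 => /(_ isT); rewrite (bigD1 'e_max) //= eqxx scale1r.
  by rewrite big1 ?addr0 // => j /negPf->; rewrite scale0r.
pose mu j := - (dot (col j b) l / dot l l).
pose w j := col j b + (if j == 'e_max then 0 else mu j) *: l.
have w0 j : w j != 0.
  rewrite /w; case: (eqVneq j 'e_max) => [->|jm]; first by rewrite scale0r addr0.
  rewrite (_ : _ + _ = \sum_i ((i == j)%:R + (i == 'e_max)%:R * mu j) *: col i b).
    by apply: (col_neq0 _ j); rewrite eqxx (negPf jm) mul0r addr0 oner_eq0.
  under eq_bigr do rewrite scalerDl; rewrite big_split /=; congr (_ + _).
    by rewrite (bigD1 j) //= eqxx scale1r big1 ?addr0 // => i /negPf->; rewrite scale0r.
  rewrite (bigD1 'e_max) //= eqxx mul1r big1 ?addr0 // => i /negPf->.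
  by rewrite mul0r scale0r.
pose r j := (Num.sqrt (dot (w j) (w j)))^-1.
have r0 j : 0 < r j by rewrite invr_gt0 sqrtr_gt0 dot_gt0.
pose c := \matrix_(i, j) (r j *: w j) i 0.
have colc j : col j c = r j *: w j by apply/colP => i; rewrite !mxE.
have cb j : col j c = r j *: col j b +
    (if j == 'e_max then 0 else r j * mu j) *: col 'e_max b.
  rewrite colc scalerDr scalerA; congr (_ + _ *: _).
  by case: ifP; rewrite ?mulr0.
have bc j : col j b = (r j)^-1 *: col j c +
    (if j == 'e_max then 0 else - mu j / r 'e_max) *: col 'e_max c.
  have rV i : r i != 0 by rewrite gt_eqF.
  rewrite !colc !scalerA mulVf // scale1r /w eqxx scale0r addr0.
  case: (eqVneq j 'e_max) => [_|jm]; first by rewrite mul0r !scale0r !addr0.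
  by rewrite divfK // -/l -addrA -scalerDl subrr scale0r addr0.
have luneE : lune b = lune c.
  apply/seteqP; split.
    by apply: lune_subset bc => j; rewrite invr_gt0.
  exact: lune_subset cb.
exists c; split.
- apply: unitmx_kernel => y cy0.
  pose t := \sum_i y i 0 * (if i == 'e_max then 0 else r i * mu i).
  have yb : \sum_j (y j 0 * r j + (if j == 'e_max then t else 0)) *: col j b = 0.
    rewrite -[RHS]cy0 mulmx_sum_col.
    under [LHS]eq_bigr do rewrite scalerDl -scalerA.
    under [RHS]eq_bigr do rewrite cb scalerDr [X in _ + X]scalerA.
    rewrite !big_split /= -scaler_suml -/t; congr (_ + _).
    by rewrite (bigD1 'e_max) //= eqxx big1 ?addr0 // => j /negPf->; rewrite scale0r.
  have {}yb j : y j 0 * r j + (if j == 'e_max then t else 0) = 0.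
    apply: (indepb (fun j => y j 0 * r j + _)); rewrite ?inE // -[RHS]yb.
    by apply: eq_bigl => i; rewrite inE.
  have yj j : j != 'e_max -> y j 0 = 0.
    move=> jm; have /eqP := yb j; rewrite (negPf jm) addr0 mulf_eq0.
    by rewrite [r j == 0]gt_eqF // orbF => /eqP.
  apply/colP => j; rewrite mxE; have [->|/yj //] := eqVneq j 'e_max.
  have /eqP := yb 'e_max; rewrite eqxx /t big1 ?addr0.
    by rewrite mulf_eq0 [r _ == 0]gt_eqF // orbF => /eqP.
  by move=> i _; case: eqVneq => [_|/yj->]; rewrite ?mulr0 ?mul0r.
- by move=> j; rewrite colc; exact: usphere_normalize.
- move=> j jm; rewrite -/(dot _ _) !colc dotZ /w eqxx scale0r addr0 (negPf jm) -/l.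
  have -> : dot (col j b + mu j *: l) l = 0; last by rewrite mulr0.
  have -> : dot (col j b + mu j *: l) l = dot (col j b) l + mu j * dot l l.
    rewrite !dotE mulr_sumr -big_split; apply: eq_bigr => i _ /=.
    by rewrite !mxE; ring.
  by rewrite /mu mulNr divfK ?subrr // gt_eqF // dot_gt0.
- by rewrite luneE -cone_negate_lastU setIUr.
Qed.

(** The two simplices form a lune, which is a suspension. *)
Lemma sclass_negate_last b : b \in unitmx ->
  sclass (cone_section (usphere R n) finset.setT (negate_last b)) =
  - sclass (cone_section (usphere R n) finset.setT b).
Proof.
move=> bu; have indepb := unitmx_independent bu.
have indepnb : independent [set: 'I_n.+1]%SET (negate_last b).
  apply: independent_scale (fun j _ => col_negate_last b j) indepb => j.
  by case: ifP; rewrite ?oppr_eq0 oner_eq0.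
have simplex_of c : independent [set: 'I_n.+1]%SET c ->
    is_polytope (usphere R n) (cone_section (usphere R n) finset.setT c).
  move=> indepc; apply/simplex_polytope/cone_section_simplex => //.
    by rewrite cardsT card_ord.
  move=> k _; apply: usphere_meets_ray; apply/eqP => ck0.
  have := indepc (fun j => (j == k)%:R) _ k; rewrite eqxx inE => one0.
  have /eqP : 1 = 0 :> R; last by rewrite oner_eq0.
  apply: one0 => //; rewrite (bigD1 k) ?inE //= eqxx ck0 scaler0 add0r.
  by rewrite big1 // => j /andP[_ /negPf->]; rewrite scale0r.
have luneE : cone_section (usphere R n) finset.setT b `|`
    cone_section (usphere R n) finset.setT (negate_last b) = usphere R n `&` lune b.
  by rewrite -setIUr cone_negate_lastU.
apply/eqP; rewrite -addr_eq0 addrC; apply/eqP.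
rewrite /sclass -scissors_classU; [|exact: simplex_of|exact: simplex_of|].
  rewrite luneE scissors_class_eq0 //; first by rewrite -luneE; apply: polytopeU; exact: simplex_of.
  exact: lune_suspension.
apply: thinS (cone_facet_thin _ indepb (finset.in_setT 'e_max)); last by rewrite cardsT card_ord.
move=> v [[_ /cone_setT[a a0 va]] [_ /cone_setT[a' a'0 va']]].
have amax : a 'e_max = 0.
  have : a 'e_max - a' 'e_max * (if 'e_max == 'e_max then -1 else 1) = 0.
    apply: (indepb (fun j => a j - a' j * (if j == 'e_max then -1 else 1))); rewrite ?inE //.
    under eq_bigr do rewrite scalerBl -scalerA -col_negate_last.
    rewrite sumrB; apply/eqP; rewrite subr_eq0; apply/eqP.
    rewrite (eq_bigl xpredT) => [|j]; last by rewrite inE.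
    by rewrite -va [RHS](eq_bigl xpredT) => [|j]; rewrite ?inE.
  by rewrite eqxx mulrN1 opprK => /eqP; rewrite paddr_eq0 ?a0 ?a'0 // => /andP[/eqP].
by exists a => //; rewrite va sum_setD1_zero //; apply: eq_bigl => j; rewrite inE.
Qed.

Lemma sclass_negate m (I : {set 'I_m}) (V V' : 'M[R]_(n.+1, m)) k :
  #|I| = n.+1 -> independent I V -> k \in I -> col k V' = - col k V ->
  (forall l, l \in I :\ k -> col l V' = col l V) ->
  sclass (cone_section (usphere R n) I V') = - sclass (cone_section (usphere R n) I V).
Proof.
move=> cardI indepI kI V'k V'l.
have [e eI ek] := exists_enumeration cardI kI; have [einj _] := eI.
rewrite /cone_section !(cone_colsub _ eI).
have -> : colsub e V' = negate_last (colsub e V).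
  apply/matrixP => i j; rewrite !mxE.
  have := V'l (e j); rewrite !inE (enumerates_in j eI) andbT -ek (inj_eq einj).
  case: eqVneq => [-> _|_ /(_ isT)/colP/(_ i)]; last by rewrite !mxE.
  by move/colP: V'k => /(_ i); rewrite -ek !mxE.
exact/sclass_negate_last/(independent_unitmx eI).
Qed.

(** Since negating a vertex only changes the sign of a class, both signs may be
    assumed to occur in the relation. *)
Lemma sphere_flip m (V : 'M[R]_(n.+1, m)) (K : {set 'I_m}) (lam : 'I_m -> R) :
  #|K| = n.+2 -> \sum_(k in K) lam k *: col k V = 0 ->
  (forall k, k \in K -> col k V != 0) ->
  (forall k, k \in K -> lam k != 0 -> independent (K :\ k) V) ->
  \sum_(k in K) ((sgz (lam k))%:~R : zhalf) *:
    sclass (cone_section (usphere R n) (K :\ k) V) = 0.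
Proof.
move=> cardK lam0 V0 indepK.
have cardD k : k \in K -> #|K :\ k| = n.+1.
  by move=> kK; have := cardsD1 k K; rewrite kK cardK => -[].
have [/exists_inP[k0 k0K lamk0]|/exists_inPn nolam] := boolP [exists k in K, lam k != 0]; last first.
  apply: big1 => k kK; have /eqP -> : lam k == 0 by have := nolam k kK; rewrite negbK.
  by rewrite sgz0 scale0r.
have [k1 k1K /andP[k10 lamk1]] : exists2 k1, k1 \in K & (k1 != k0) && (lam k1 != 0).
  have [/exists_inP //|/exists_inPn nolam] :=
    boolP [exists k1 in K, (k1 != k0) && (lam k1 != 0)].
  move: lam0; rewrite (bigD1 k0) //= big1 ?addr0 => [/eqP|k /andP[kK kk0]]; last first.
    by have := nolam k kK; rewrite kk0 /= negbK => /eqP ->; rewrite scale0r.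
  by rewrite scaler_eq0 (negPf lamk0) (negPf (V0 k0 k0K)).
have both_signs (l : 'I_m -> R) k k' : k \in K -> k' \in K -> l k * l k' < 0 ->
    (exists2 k, k \in K & 0 < l k) /\ (exists2 k, k \in K & l k < 0).
  move=> kK k'K; have [lk|lk|->] := ltgtP (l k) 0; last by rewrite mul0r ltxx.
    by rewrite nmulr_rlt0 // => lk'; split; [exists k'|exists k].
  by rewrite pmulr_rlt0 // => lk'; split; [exists k|exists k'].
have [lam01|lam01] := ltP (lam k0 * lam k1) 0.
  have [pos neg] := both_signs lam k0 k1 k0K k1K lam01.
  by apply: flip => // k kK; exact/usphere_meets_ray/V0.
pose r k : R := if k == k0 then -1 else 1.
have r0 k : r k != 0 by rewrite /r; case: ifP; rewrite ?oppr_eq0 oner_eq0.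
pose V' := \matrix_(i, k) (r k * V i k).
have colV' k : col k V' = r k *: col k V by apply/colP => i; rewrite !mxE.
pose lam' k := r k * lam k.
have lam'01 : lam' k0 * lam' k1 < 0.
  rewrite /lam' /r eqxx (negPf k10) mulN1r mul1r mulNr oppr_lt0 lt_def lam01 andbT.
  by rewrite mulf_neq0.
have [pos neg] := both_signs lam' k0 k1 k0K k1K lam'01.
have : \sum_(k in K) ((sgz (lam' k))%:~R : zhalf) *:
    sclass (cone_section (usphere R n) (K :\ k) V') = 0.
  apply: flip => //.
  - rewrite -[RHS]lam0; apply: eq_bigr => k _; rewrite colV' scalerA /lam' mulrAC.
    by rewrite /r; case: ifP; rewrite ?mulrNN ?mulr1 ?mul1r.
  - move=> k kK; apply: usphere_meets_ray; rewrite colV' scaler_eq0 negb_or r0.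
    exact: V0.
  - move=> k kK; rewrite mulf_eq0 (negPf (r0 k)) /= => lamk.
    by apply: independent_scale (fun k _ => colV' k) (indepK k kK lamk).
move=> flip'; rewrite -[LHS]opprK -[RHS]oppr0 -[in RHS]flip' -sumrN; congr (- _).
apply: eq_bigr => k kK; rewrite -scaleNr.
rewrite /lam' /r; have [-> | kk0] := eqVneq k k0.
  rewrite mulN1r sgzN mulrNz; congr (_ *: _).
  rewrite (@cone_section_scale _ _ _ _ _ V V' (fun=> 1)) // => l.
  by rewrite !inE colV' /r => /andP[/negPf->].
rewrite mul1r; have [->|lamk] := eqVneq (lam k) 0; first by rewrite sgz0 oppr0 !scale0r.
rewrite [in RHS](@sclass_negate _ _ V V' k0) ?scalerN ?scaleNr //.
- exact: cardD.
- exact: indepK.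
- by rewrite !inE eq_sym kk0.
- by rewrite colV' /r eqxx scaleN1r.
- by move=> l; rewrite colV' /r !inE => /andP[/negPf->]; rewrite scale1r.
Qed.

End Sphere.

(** * Lorentz geometry *)

Section Lorentz.
Variables (R : realType).
Local Notation J := (lorentz_mx R).

Definition lform d (u v : 'cV[R]_d.+1) : R := (u^T *m J d *m v) 0 0.

Lemma lformE d (u v : 'cV[R]_d.+1) :
  lform u v = \sum_(j | j != 0) u j 0 * v j 0 - u 0 0 * v 0 0.
Proof.
rewrite /lform -mulmxA mxE (bigD1 0) //= addrC; congr (_ + _).
  apply: eq_bigr => j j0; rewrite mul_diag_mx !mxE (negPf j0) mul1r.
  by [].
by rewrite mul_diag_mx !mxE eqxx mulN1r mulrN.
Qed.

Lemma lform_mul d p q (A : 'M[R]_(d.+1, p)) (B : 'M[R]_(d.+1, q))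
    (u : 'cV[R]_p) (v : 'cV[R]_q) :
  lform (A *m u) (B *m v) = (u^T *m (A^T *m J d *m B) *m v) 0 0.
Proof. by rewrite /lform trmx_mul !mulmxA. Qed.

Lemma lorentz_mx_tr d : (J d)^T = J d.
Proof. by rewrite /lorentz_mx tr_diag_mx. Qed.

(** Expanding [(u_j v_0 - v_j u_0)^2 >= 0] replaces the Cauchy-Schwarz
    inequality. *)
Lemma lform_hyperbolic_lt0 d (u v : 'cV[R]_d.+1) :
  hyperbolic R d u -> hyperbolic R d v -> lform u v < 0.
Proof.
move=> [+ u0] [+ v0]; rewrite -/(lform u u) -/(lform v v) !lformE => hu hv.
have : 0 <= \sum_(j | j != 0) (u j 0 * v 0 0 - v j 0 * u 0 0) ^+ 2.
  by apply: sumr_ge0 => j _; exact: sqr_ge0.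
rewrite (eq_bigr (fun j => v 0 0 ^+ 2 * (u j 0 * u j 0) + u 0 0 ^+ 2 * (v j 0 * v j 0)
   - 2 * u 0 0 * v 0 0 * (u j 0 * v j 0))) => [|j _]; last by ring.
rewrite sumrB big_split /= -!mulr_sumr.
set Suu := \sum_(j | j != 0) u j 0 * u j 0 in hu *.
set Svv := \sum_(j | j != 0) v j 0 * v j 0 in hv *.
set Suv := \sum_(j | j != 0) u j 0 * v j 0.
have -> : Suu = u 0 0 * u 0 0 - 1 by rewrite -hu; ring.
have -> : Svv = v 0 0 * v 0 0 - 1 by rewrite -hv; ring.
move: (u 0 0) (v 0 0) u0 v0 => a b a0 b0 sq_ge0.
have ab0 : 0 < a * b by exact: mulr_gt0.
have : 2 * (a * b) * (Suv - a * b) < 0 by nra.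
by rewrite pmulr_rlt0 // mulr_gt0.
Qed.

Lemma lform_orthogonal_gt0 d (u v : 'cV[R]_d.+1) :
  hyperbolic R d u -> lform u v = 0 -> v != 0 -> 0 < lform v v.
Proof.
move=> [+ u0]; rewrite -/(lform u u) !lformE => hu uv v_neq0.
pose sq := \sum_(j | j != 0) (u 0 0 * v j 0 - v 0 0 * u j 0) ^+ 2.
have sq_ge0 : 0 <= sq by apply: sumr_ge0 => j _; exact: sqr_ge0.
have sqE : u 0 0 ^+ 2 * (\sum_(j | j != 0) v j 0 * v j 0 - v 0 0 * v 0 0) =
    sq + v 0 0 ^+ 2.
  have -> : sq = \sum_(j | j != 0) (u 0 0 ^+ 2 * (v j 0 * v j 0) +
      v 0 0 ^+ 2 * (u j 0 * u j 0) - 2 * u 0 0 * v 0 0 * (u j 0 * v j 0)).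
    by apply: eq_bigr => j _; ring.
  rewrite sumrB big_split /= -!mulr_sumr.
  have -> : \sum_(j | j != 0) u j 0 * u j 0 = u 0 0 * u 0 0 - 1 by rewrite -hu; ring.
  have -> : \sum_(j | j != 0) u j 0 * v j 0 = u 0 0 * v 0 0.
    by apply/eqP; rewrite -subr_eq0 uv.
  by ring.
rewrite -(pmulr_rgt0 _ (exprn_gt0 2 u0)) sqE lt_def addr_ge0 ?sqr_ge0 // andbT.
rewrite paddr_eq0 ?sqr_ge0 //; apply: contraNN v_neq0 => /andP[/eqP sq0 /eqP v00].
have {}v00 : v 0 0 = 0 by apply/eqP; rewrite -sqrf_eq0 v00.
apply/eqP/colP => j; rewrite mxE; have [->//|j0] := eqVneq j 0.
have /eqP := psumr_eq0P (fun i _ => sqr_ge0 _) sq0 j0.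
rewrite v00 mul0r subr0 sqrf_eq0 mulf_eq0 (gt_eqF u0) /=.
by move=> /eqP.
Qed.

Section Group.
Variable d : nat.
Implicit Types (g h : lorentz R d) (v : 'cV[R]_d.+1).

Lemma lorentzP g : (val g)^T *m J d *m val g = J d.
Proof. exact/eqP/(valP g). Qed.

Lemma lform_lorentz g u v : lform (val g *m u) (val g *m v) = lform u v.
Proof. by rewrite lform_mul lorentzP. Qed.

Definition origin : 'cV[R]_d.+1 := delta_mx 0 0.

Lemma origin_hyperbolic : hyperbolic R d origin.
Proof.
split; last by rewrite mxE !eqxx ltr01.
rewrite -/(lform _ _) lformE !mxE eqxx mulr1 big1 ?sub0r // => j j0.
by rewrite !mxE (negPf j0) mul0r.
Qed.

Definition sheet_sign g : R := Num.sg (val g 0 0).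

Lemma first_coord_neq0 v : lform v v = -1 -> v 0 0 != 0.
Proof.
move=> hv; apply/eqP => v0; move: hv; rewrite lformE v0 mul0r subr0 => hv.
have : 0 <= \sum_(j | j != 0) v j 0 * v j 0.
  by apply: sumr_ge0 => j _; rewrite -expr2 sqr_ge0.
by rewrite hv oppr_ge0 ler10.
Qed.

Lemma lform_scale (a b : R) u v : lform (a *: u) (b *: v) = a * b * lform u v.
Proof.
by rewrite /lform [(a *: u)^T]linearZ /= -!scalemxAl -scalemxAr scalerA mxE.
Qed.

(** The sign by which a Lorentz transformation permutes the sheets can be read
    off any point: points of one sheet have negative product. *)
Lemma lorentz_actE g v : hyperbolic R d v ->
  lorentz_act g v = sheet_sign g *: (val g *m v) /\ hyperbolic R d (lorentz_act g v).
Proof.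
have sheet w : hyperbolic R d w ->
    hyperbolic R d (Num.sg ((val g *m w) 0 0) *: (val g *m w)).
  move=> [hw w0]; rewrite -/(lform _ _) in hw.
  have gw0 := first_coord_neq0 (etrans (lform_lorentz g w w) hw).
  split; last by rewrite mxE -normrEsg normr_gt0.
  by rewrite -/(lform _ _) lform_scale -expr2 sqr_sg gw0 mul1r lform_lorentz.
move=> hv; split; last exact: sheet.
have := lform_hyperbolic_lt0 (sheet _ hv) (sheet _ origin_hyperbolic).
rewrite lform_scale lform_lorentz /lorentz_act /sheet_sign.
have -> : (val g *m origin) 0 0 = val g 0 0.
  by rewrite /origin -colE mxE.
have hvo := lform_hyperbolic_lt0 hv origin_hyperbolic.
by rewrite nmulr_llt0 //; case: sgrP => _; case: sgrP => _;
  rewrite ?mulr0 ?mul0r ?ltxx ?mulrN1 ?mulr1 ?mulN1r ?ltr0N1 //.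
Qed.

Lemma lorentz_act_hyperbolic g v : hyperbolic R d v -> hyperbolic R d (lorentz_act g v).
Proof. by move=> hv; have [] := lorentz_actE g hv. Qed.

Lemma sheet_signM g h : sheet_sign (g * h)%g = sheet_sign g * sheet_sign h.
Proof.
have [gE [_ gpos]] := lorentz_actE g (lorentz_act_hyperbolic h origin_hyperbolic).
have [hE _] := lorentz_actE h origin_hyperbolic.
have ghE : val (g * h)%g 0 0 = (val g *m (val h *m origin)) 0 0.
  by rewrite mulmxA /origin -colE [in RHS]mxE.
move: gpos; rewrite gE hE -scalemxAr scalerA mxE -ghE => gh0.
have : Num.sg (sheet_sign g * sheet_sign h * val (g * h)%g 0 0) = 1 by rewrite gtr0_sg.
rewrite !sgrM /sheet_sign !sgr_id => /(congr1 ( *%R (Num.sg (val g 0 0) * Num.sg (val h 0 0)))).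
rewrite mulr1 => <-; rewrite mulrA -expr2 exprMn !sqr_sg.
have neq0 (k : lorentz R d) : val k 0 0 != 0.
  have [_ ho] := lorentz_actE k origin_hyperbolic; case: ho => _.
  rewrite /lorentz_act (_ : val k *m origin = col 0 (val k)); last by rewrite /origin -colE.
  by rewrite !mxE; apply: contraTneq => ->; rewrite mulr0 ltxx.
by rewrite !neq0 !mul1r.
Qed.

Lemma sheet_sign_sqr g : sheet_sign g * sheet_sign g = 1.
Proof.
have [_ [ho _]] := lorentz_actE g origin_hyperbolic.
move: ho; have [-> _] := lorentz_actE g origin_hyperbolic.
rewrite -/(lform _ _) lform_scale lform_lorentz.
have [oo _] := origin_hyperbolic; rewrite -/(lform _ _) in oo.
by rewrite oo mulrN1 => /oppr_inj.
Qed.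

Lemma sheet_sign_neq0 g : sheet_sign g != 0.
Proof. by apply/eqP => e0; have /eqP := sheet_sign_sqr g; rewrite e0 mul0r eq_sym oner_eq0. Qed.

Lemma lorentz_actM g h v : hyperbolic R d v ->
  lorentz_act (g * h)%g v = lorentz_act g (lorentz_act h v).
Proof.
move=> hv; have hhv := lorentz_act_hyperbolic h hv.
have [-> _] := lorentz_actE (g * h)%g hv; have [-> _] := lorentz_actE g hhv.
have [-> _] := lorentz_actE h hv.
by rewrite -scalemxAr scalerA sheet_signM mulmxA.
Qed.

Lemma lorentz_det_sqr g : \det (val g) ^+ 2 = 1.
Proof.
have := congr1 (@determinant _ _) (lorentzP g); rewrite !detM det_tr mulrAC.
have J0 : \det (J d) != 0.
  by rewrite det_diag; apply/prodf_neq0 => j _; rewrite mxE; case: ifP;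
    rewrite ?oppr_eq0 oner_eq0.
by rewrite -expr2 -[RHS]mul1r => /(mulIf J0).
Qed.

Lemma det_sign_sqr g : det_sign g * det_sign g = 1.
Proof.
have := lorentz_det_sqr g; rewrite /det_sign -intrM -sgzM -expr2 => ->.
by rewrite sgz1.
Qed.

End Group.

(** * Frames *)

Section Frames.
Variables (d i m : nat) (dim_sum : d = (i + m).+1).
Implicit Types (A : 'M[R]_(d.+1, i.+1)) (B : 'M[R]_(d.+1, m.+1)).

Definition frame A B :=
  [/\ A^T *m J d *m A = J i, 0 < A 0 0, B^T *m J d *m B = 1%:M &
      A^T *m J d *m B = 0].

Definition coordA A : 'M[R]_(i.+1, d.+1) := J i *m A^T *m J d.
Definition coordB B : 'M[R]_(m.+1, d.+1) := B^T *m J d.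

(** The Lorentz orthogonal projector onto the column space of [A]. *)
Definition projector A : 'M[R]_d.+1 := A *m coordA A.

Lemma mulmx_left_inverse p q (M : 'M[R]_(p, q)) (N : 'M[R]_(q, p)) :
  p = q -> N *m M = 1%:M -> M *m N = 1%:M.
Proof. by move=> e; case: q / e M N => M N; exact: mulmx1C. Qed.

Section OneFrame.
Variables (A : 'M[R]_(d.+1, i.+1)) (B : 'M[R]_(d.+1, m.+1)).
Hypothesis AB : frame A B.

Lemma coordAA : coordA A *m A = 1%:M.
Proof. by case: AB => AA _ _ _; rewrite /coordA -!mulmxA (mulmxA A^T) AA lorentz_mxK. Qed.

Lemma coordAB : coordA A *m B = 0.
Proof. by case: AB => _ _ _ A_B; rewrite /coordA -!mulmxA (mulmxA A^T) A_B mulmx0. Qed.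

Lemma coordBB : coordB B *m B = 1%:M.
Proof. by case: AB. Qed.

Lemma coordBA : coordB B *m A = 0.
Proof.
case: AB => _ _ _ /(congr1 trmx); rewrite !trmx_mul trmxK lorentz_mx_tr trmx0.
by rewrite mulmxA.
Qed.

Lemma projectorA : projector A *m A = A.
Proof. by rewrite /projector -mulmxA coordAA mulmx1. Qed.

Lemma projectorB : projector A *m B = 0.
Proof. by rewrite /projector -mulmxA coordAB mulmx0. Qed.

Lemma coordA_projector : coordA A *m projector A = coordA A.
Proof. by rewrite /projector mulmxA coordAA mul1mx. Qed.

Lemma coordB_projector : coordB B *m projector A = 0.
Proof. by rewrite /projector mulmxA coordBA mul0mx. Qed.

Lemma frame_complete : projector A + B *m coordB B = 1%:M.
Proof.
have := @mulmx_left_inverse _ _ (row_mx A B) (col_mx (coordA A) (coordB B)).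
rewrite mul_row_col; apply; first by rewrite dim_sum addSn addnS.
by rewrite mul_col_row coordAA coordAB coordBB coordBA -scalar_mx_block.
Qed.

Lemma frame_origin : hyperbolic R d (A *m origin i).
Proof.
case: AB => AA A0 _ _; split; last by rewrite /origin -colE mxE.
by rewrite -/(lform _ _) lform_mul AA; have [] := origin_hyperbolic i.
Qed.

Lemma coordA_hyperbolic (v : 'cV[R]_d.+1) :
  hyperbolic R d v -> projector A *m v = v -> hyperbolic R i (coordA A *m v).
Proof.
move=> hv Av; have vA : v = A *m (coordA A *m v) by rewrite mulmxA.
case: AB => AA _ _ _; split.
  by have [] := hv; rewrite -!/(lform _ _) {1 2}vA lform_mul AA.
have := lform_hyperbolic_lt0 frame_origin hv.
rewrite {1}vA lform_mul AA -/(lform _ _) lformE mxE !eqxx mul1r big1 ?sub0r ?oppr_lt0 //.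
by move=> j j0; rewrite !mxE (negPf j0) mul0r.
Qed.

End OneFrame.

End Frames.
End Lorentz.

(** * Isometries and independence *)

Section Classes.
Variable (R : realType).
Local Notation J := (lorentz_mx R).

Lemma cone_mul n p m (I : {set 'I_m}) (M : 'M[R]_(p.+1, n.+1)) (V : 'M[R]_(n.+1, m)) v :
  cone I (M *m V) v <-> exists2 w, cone I V w & v = M *m w.
Proof.
split=> [[c c0 ->]|[_ [c c0 ->] ->]].
  exists (\sum_(k in I) c k *: col k V); first by exists c.
  by rewrite mulmx_sumr; apply: eq_bigr => k _; rewrite col_mul scalemxAr.
exists c => //; rewrite mulmx_sumr; apply: eq_bigr => k _.
by rewrite col_mul scalemxAr.
Qed.

Lemma independent_mul n m (I : {set 'I_m}) (M : 'M[R]_n.+1) (V : 'M[R]_(n.+1, m)) :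
  M \in unitmx -> independent I V -> independent I (M *m V).
Proof.
move=> Mu indepV c cMV; apply: indepV; rewrite -[LHS](mulKmx Mu).
rewrite mulmx_sumr (eq_bigr (fun k => c k *: col k (M *m V))) ?cMV ?mulmx0 //.
by move=> k _; rewrite col_mul scalemxAr.
Qed.

Lemma lorentz_unitmx d (g : lorentz R d) : val g \in unitmx.
Proof.
rewrite unitmxE unitfE; apply/eqP => g0; have /eqP := lorentz_det_sqr g.
by rewrite g0 expr0n eq_sym oner_eq0.
Qed.

Lemma hyperbolic_meets_ray d (v : 'cV[R]_d.+1) :
  hyperbolic R d v -> meets_ray (hyperbolic R d) v.
Proof. by move=> hv; exists 1; rewrite ?scale1r. Qed.

Lemma hclass_lorentz d m (I : {set 'I_m}) (V : 'M[R]_(d.+1, m)) (g : lorentz R d) :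
  #|I| = d.+1 -> independent I V -> (forall k, k \in I -> hyperbolic R d (col k V)) ->
  hclass (cone_section (hyperbolic R d) I (sheet_sign g *: (val g *m V))) =
  hclass (cone_section (hyperbolic R d) I V).
Proof.
move=> cardI indepV hV.
have gV k : k \in I -> hyperbolic R d (col k (sheet_sign g *: (val g *m V))).
  move=> kI; rewrite linearZ /= col_mul; have [<- //] := lorentz_actE g (hV k kI).
have imageE : lorentz_act g @` cone_section (hyperbolic R d) I V =
    cone_section (hyperbolic R d) I (sheet_sign g *: (val g *m V)).
  rewrite scalemxAl; apply/seteqP; split=> v.
    move=> [w [hw Vw] <-]; have [gw hgw] := lorentz_actE g hw; split=> //.
    by apply/cone_mul; exists w; rewrite // gw scalemxAl.
  move=> [hv /cone_mul[w Vw vw]].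
  have hw : hyperbolic R d (lorentz_act g^-1%g v).
    exact: lorentz_act_hyperbolic.
  have vE : v = lorentz_act g (lorentz_act g^-1%g v).
    rewrite -lorentz_actM // mulgV; have [-> _] := lorentz_actE 1%g hv.
    by rewrite /sheet_sign mxE eqxx sgr1 scale1r mul1mx.
  have wE : w = lorentz_act g^-1%g v.
    have [gE _] := lorentz_actE g hw.
    have gu : sheet_sign g *: val g \in unitmx.
      by rewrite unitmxZ ?lorentz_unitmx // unitfE sheet_sign_neq0.
    rewrite -[LHS](mulKmx gu) -[RHS](mulKmx gu) -vw {1}vE gE.
    by rewrite scalemxAl.
  by exists w; [split; rewrite // wE | rewrite wE -vE].
rewrite -imageE /hclass scissors_class_isom //; first by exists g.
  apply/simplex_polytope/cone_section_simplex => // k kI.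
  exact/hyperbolic_meets_ray/hV.
rewrite imageE; apply/simplex_polytope/cone_section_simplex => //.
  rewrite scalemxAl; apply: independent_mul => //.
  by rewrite unitmxZ ?lorentz_unitmx // unitfE sheet_sign_neq0.
by move=> k kI; apply/hyperbolic_meets_ray/gV.
Qed.

Lemma sclass_orthogonal n m (I : {set 'I_m}) (V : 'M[R]_(n.+1, m)) (g : 'M[R]_n.+1) :
  g^T *m g = 1%:M -> #|I| = n.+1 -> independent I V ->
  (forall k, k \in I -> col k V != 0) ->
  sclass (cone_section (usphere R n) I (g *m V)) =
  sclass (cone_section (usphere R n) I V).
Proof.
move=> gg cardI indepV V0.
have gu : g \in unitmx by have [] := mulmx1_unit gg.
have gS v : usphere R n (g *m v) <-> usphere R n v.
  by rewrite /usphere /= trmx_mul !mulmxA -(mulmxA _ _ g) gg mulmx1.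
have imageE : mulmx g @` cone_section (usphere R n) I V =
    cone_section (usphere R n) I (g *m V).
  apply/seteqP; split=> v.
    move=> [w [Sw Vw] <-]; split; first exact/gS.
    by apply/cone_mul; exists w.
  move=> [Sv /cone_mul[w Vw vw]]; exists w => //; split=> //.
  by apply/gS; rewrite -vw.
have ray k : k \in I -> meets_ray (usphere R n) (col k V).
  by move=> kI; exact/usphere_meets_ray/V0.
have gray k : k \in I -> meets_ray (usphere R n) (col k (g *m V)).
  move=> /ray[r r0 rV]; exists r => //; rewrite col_mul scalemxAr; exact/gS.
rewrite -imageE /sclass scissors_class_isom //; first by exists g.
  exact/simplex_polytope/cone_section_simplex.
rewrite imageE; apply/simplex_polytope/cone_section_simplex => //.
exact: independent_mul.
Qed.

Lemma independentS n m (I I' : {set 'I_m}) (V : 'M[R]_(n.+1, m)) :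
  I' \subset I -> independent I V -> independent I' V.
Proof.
move=> /fintype.subsetP sub indepV c cV k kI'.
have := indepV (fun k => if k \in I' then c k else 0) _ k (sub k kI').
rewrite kI'; apply; rewrite -[RHS]cV [RHS]big_mkcond /= big_mkcond /=.
apply: eq_bigr => j _; case: ifP => [|jI]; case: ifP => //.
  by move=> _ _; rewrite scale0r.
by move=> /sub; rewrite jI.
Qed.

Lemma independent_neq0 n m (I : {set 'I_m}) (V : 'M[R]_(n.+1, m)) k :
  independent I V -> k \in I -> col k V != 0.
Proof.
move=> indepV kI; apply/eqP => Vk0.
have /eqP : (k == k)%:R = 0 :> R; last by rewrite eqxx oner_eq0.
apply: (indepV (fun j => (j == k)%:R)) => //; rewrite (bigD1 k) //= Vk0 scaler0.
by rewrite add0r big1 // => j /andP[_ /negPf->]; rewrite scale0r.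
Qed.

Lemma independent_card n m (I : {set 'I_m}) (V : 'M[R]_(n.+1, m)) :
  independent I V -> (#|I| <= n.+1)%N.
Proof.
move=> indepV; have [->|/set0Pn[k kI]] := eqVneq I finset.set0.
  by rewrite cards0.
have [p cardI] : exists p, #|I| = p.+1.
  by exists #|I|.-1; rewrite prednK // card_gt0; apply/set0Pn; exists k.
have [e eI _] := exists_enumeration cardI kI.
have free : row_free (colsub e V)^T.
  apply: inj_row_free => v vV; apply/trmx_inj; rewrite trmx0.
  by apply: (colsub_mulK eI indepV); rewrite -[RHS]trmx0 -vV trmx_mul trmxK.
by have /eqP := free; rewrite cardI => <-; exact: rank_leq_col.
Qed.

Section FrameChange.
Variables (d i m : nat) (dim_sum : d = (i + m).+1).
Implicit Types (A : 'M[R]_(d.+1, i.+1)) (B : 'M[R]_(d.+1, m.+1)).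

Lemma coordA_independent A B M (Y : 'M[R]_(d.+1, M)) (I : {set 'I_M}) :
  frame A B -> independent I Y ->
  (forall k, k \in I -> projector A *m col k Y = col k Y) ->
  independent I (coordA A *m Y).
Proof.
move=> AB indepY fixI c cAY; apply: indepY.
have <- : A *m (\sum_(k in I) c k *: col k (coordA A *m Y)) = \sum_(k in I) c k *: col k Y.
  rewrite mulmx_sumr; apply: eq_bigr => k kI.
  by rewrite -scalemxAr col_mul mulmxA -/(projector A) fixI.
by rewrite cAY mulmx0.
Qed.

(** A combination of the columns in [I'] whose [B]-coordinates vanish lies in the
    image of the projector, which the [i + 1] columns in [I] span for reasons of
    dimension; so it is a relation between the columns in [I] and [I']. *)
Lemma coordB_independent A B M (Y : 'M[R]_(d.+1, M)) (I I' : {set 'I_M}) :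
  frame A B -> #|I| = i.+1 -> [disjoint I & I']%bool -> independent (I :|: I') Y ->
  (forall k, k \in I -> projector A *m col k Y = col k Y) ->
  independent I' (coordB B *m Y).
Proof.
move=> AB cardI disj indepY fixI c cBY.
have indepAY := coordA_independent AB (independentS (finset.subsetUl I I') indepY) fixI.
have [k0 k0I] : exists k, k \in I by apply/set0Pn; rewrite -card_gt0 cardI.
have [e eI _] := exists_enumeration cardI k0I; have [einj _] := eI.
have bu := independent_unitmx eI indepAY.
pose w := \sum_(k in I') c k *: col k Y.
pose y := invmx (colsub e (coordA A *m Y)) *m (coordA A *m w).
have wB : coordB B *m w = 0.
  rewrite -[RHS]cBY mulmx_sumr; apply: eq_bigr => k _.
  by rewrite col_mul scalemxAr.
have wA : projector A *m w = w.
  by rewrite -[RHS]mul1mx -(frame_complete dim_sum AB) mulmxDl -mulmxA wB mulmx0 addr0.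
have wI : w = \sum_j y j 0 *: col (e j) Y.
  transitivity (A *m (colsub e (coordA A *m Y) *m y)).
    by rewrite mulKVmx // mulmxA.
  rewrite [colsub _ _ *m _]mulmx_sum_col mulmx_sumr; apply: eq_bigr => j _.
  by rewrite col_colsub col_mul -scalemxAr mulmxA -/(projector A) fixI // (enumerates_in j eI).
pose c' k := if k \in I' then c k else - \sum_(j | e j == k) y j 0.
move=> k kI'; have := indepY c' _ k; rewrite inE kI' orbT /c' kI'; apply => //.
rewrite (bigID (mem I')) /=; apply/eqP; rewrite addr_eq0; apply/eqP.
transitivity w.
  apply: eq_big => l; first by rewrite inE; case: (l \in I'); rewrite ?orbT ?andbF.
  by move=> /andP[_ ->].
rewrite (eq_bigl (fun l => l \in I)) => [|l]; last first.
  rewrite inE; case: (boolP (l \in I)) => [lI|_]; last by case: (l \in I').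
  by rewrite (disjointFr disj lI).
rewrite wI -sumrN (enumerates_sum _ eI) /=; apply: eq_bigr => j _.
have -> : e j \in I' = false.
  exact: disjointFr disj (enumerates_in j eI).
by rewrite scaleNr opprK (big_pred1 j) // => j'; exact: inj_eq.
Qed.

(** Two frames with the same projector differ by a Lorentz transformation that
    preserves the sheets and an orthogonal transformation, so they give the
    same coordinates up to isometry. *)
Lemma dehn_term_frame A B A' B' (Y : 'M[R]_d.+1) (I : {set 'I_d.+1}) :
  frame A B -> frame A' B' -> projector A = projector A' ->
  Y \in unitmx -> #|I| = i.+1 ->
  (forall k, k \in I -> hyperbolic R d (col k Y)) ->
  (forall k, k \in I -> projector A *m col k Y = col k Y) ->
  dehn_term Y I A' B' = dehn_term Y I A B.
Proof.
move=> AB AB' PP Yu cardI hY fixY.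
have indepY := unitmx_independent Yu.
have [AA A0 BB A_B] := AB; have [AA' A'0 BB' A_B'] := AB'.
have [k kE] : exists k, k = coordA A' *m A by exists (coordA A' *m A).
have [g gE] : exists g, g = coordB B' *m B by exists (coordB B' *m B).
have Ak : A = A' *m k by rewrite kE mulmxA -/(projector A') -PP (projectorA AB).
have Bg : B = B' *m g.
  rewrite -[LHS]mul1mx -(frame_complete dim_sum AB') mulmxDl -PP (projectorB AB).
  by rewrite add0r gE mulmxA.
have kk : lorentz_pred k.
  by apply/eqP; rewrite -[RHS]AA Ak trmx_mul -AA' !mulmxA.
pose K := Lorentz kk.
have gg : g^T *m g = 1%:M.
  by rewrite -[RHS]BB Bg trmx_mul -[g^T in LHS]mulmx1 -BB' !mulmxA.
have kA : coordA A' = k *m coordA A.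
  by rewrite kE -mulmxA -/(projector A) PP (coordA_projector AB').
have K0 : 0 < k 0 0.
  have := lform_hyperbolic_lt0 (frame_origin AB') (frame_origin AB).
  rewrite [A]Ak -mulmxA lform_mul AA' -/(lform _ _) lformE.
  rewrite big1 => [|j j0]; last by rewrite !mxE (negPf j0) mul0r.
  by rewrite sub0r oppr_lt0 mxE !eqxx mul1r /origin -colE mxE.
have gB : coordB B' = g *m coordB B.
  have := congr1 (mulmx (coordB B')) (frame_complete dim_sum AB).
  by rewrite mulmx1 mulmxDr PP (coordB_projector AB') add0r gE mulmxA.
have sK : sheet_sign K = 1 by rewrite /sheet_sign gtr0_sg.
rewrite /dehn_term -!/(coordA _) -!/(coordB _); congr tens.
  rewrite kA -mulmxA -[k *m _]scale1r -sK (hclass_lorentz K) //.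
    exact/(coordA_independent AB)/fixY/independentS/indepY/finset.subsetT.
  by move=> l lI; rewrite col_mul; apply: (coordA_hyperbolic AB); [exact: hY|exact: fixY].
have indepB : independent (~: I) (coordB B *m Y).
  apply: (coordB_independent (I := I) AB) => //.
    by rewrite -finset.setI_eq0 finset.setICr.
  by rewrite finset.setUCr.
rewrite gB -mulmxA sclass_orthogonal //.
  by have := cardsC I; rewrite card_ord cardI; lia.
by move=> l; apply: independent_neq0.
Qed.

End FrameChange.
End Classes.

(** * The cocycle relations *)

Section Cocycle.
Variable R : realType.

Lemma sum_lift p (M : nmodType) (k : 'I_p.+1) (F : {set 'I_p.+1}) (G : 'I_p.+1 -> M) :
  \sum_(l in F :\ k) G l = \sum_(j | lift k j \in F) G (lift k j).
Proof.
rewrite (reindex_omap (lift k) (unlift k)) => [|l]; last first.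
  by rewrite !inE => /andP[lk _]; case: unliftP lk => [j ->|->]; rewrite ?eqxx.
by apply: eq_bigl => j; rewrite !inE liftK eqxx andbT eq_sym neq_lift.
Qed.

Lemma card_lift p (k : 'I_p.+1) (F : {set 'I_p.+1}) :
  #|[set j | lift k j \in F]%SET| = #|F :\ k|.
Proof.
by rewrite -!sum1_card sum_lift; apply: eq_bigl => j; rewrite inE.
Qed.

Lemma col_col' n p (V : 'M[R]_(n, p.+1)) k j : col j (col' k V) = col (lift k j) V.
Proof. by apply/colP => i; rewrite !mxE. Qed.

Lemma mul_col' n q p (A : 'M[R]_(q, n)) (V : 'M[R]_(n, p.+1)) k :
  A *m col' k V = col' k (A *m V).
Proof. by apply/matrixP => i j; rewrite !mxE; apply: eq_bigr => l _; rewrite !mxE. Qed.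

Lemma cone_col' n p (V : 'M[R]_(n.+1, p.+1)) k (F : {set 'I_p.+1}) :
  cone [set j | lift k j \in F]%SET (col' k V) = cone (F :\ k) V.
Proof.
apply/seteqP; split=> v [c c0 ->].
  exists (fun l => if unlift k l is Some j then c j else 0) => [l|].
    by case: unliftP.
  rewrite sum_lift; apply: eq_big => j; first by rewrite inE.
  by rewrite liftK col_col'.
exists (fun j => c (lift k j)) => [j|]; first exact: c0.
rewrite sum_lift; apply: eq_big => j; first by rewrite inE.
by rewrite col_col'.
Qed.

(** Each coordinate is the expansion of a determinant with a repeated row. *)
Lemma cramer_relation n (W : 'M[R]_(n, n.+1)) :
  \sum_(k < n.+1) ((-1) ^+ k * \det (col' k W)) *: col k W = 0.
Proof.
apply/colP => r; rewrite summxE mxE.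
pose M := col_mx (row r W) W : 'M[R]_n.+1.
have Mu j : M 0 j = W r j.
  transitivity (row r W 0 j); last by rewrite mxE.
  rewrite (_ : 0 = lshift n (0 : 'I_1)); last exact: val_inj.
  exact: (@col_mxEu _ 1 n).
have Md s j : M (lift 0 s) j = W s j.
  rewrite (_ : lift 0 s = rshift 1 s); last exact: val_inj.
  exact: (@col_mxEd _ 1 n).
have M0 : \det M = 0.
  apply: (@determinant_alternate _ _ _ 0 (lift 0 r)); first exact: neq_lift.
  by move=> j; rewrite Mu Md.
rewrite -[RHS]M0 (expand_det_row _ 0); apply: eq_bigr => k _.
rewrite Mu !mxE mulrC; congr (_ * _).
rewrite /cofactor add0n; congr (_ * \det _); apply/matrixP => s j.
by rewrite [in RHS]mxE [in RHS]mxE Md mxE.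
Qed.

Lemma unitmx_det n (b : 'M[R]_n) : (b \in unitmx) = (\det b != 0).
Proof. by rewrite unitmxE unitfE. Qed.

Lemma independent_col' n (W : 'M[R]_(n.+1, n.+2)) k :
  \det (col' k W) != 0 -> independent ([set: 'I_n.+2] :\ k)%SET W.
Proof.
rewrite -unitmx_det => /unitmx_independent indepW c cW.
have cl j : c (lift k j) = 0.
  apply: (indepW (fun j => c (lift k j))); rewrite ?inE // -[RHS]cW sum_lift.
  by apply: eq_big => l; rewrite ?inE // col_col'.
move=> l; rewrite !inE andbT; case: (unliftP k l) => [j ->|->]; first by rewrite cl.
by rewrite eqxx.
Qed.

(** First coordinates are positive, so both signs occur in any nontrivial
    linear relation between points of hyperbolic space. *)
Lemma hyperbolic_flip n m (V : 'M[R]_(n.+1, m)) (K : {set 'I_m}) (lam : 'I_m -> R) :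
  #|K| = n.+2 -> \sum_(k in K) lam k *: col k V = 0 ->
  (forall k, k \in K -> hyperbolic R n (col k V)) ->
  (forall k, k \in K -> lam k != 0 -> independent (K :\ k) V) ->
  \sum_(k in K) ((sgz (lam k))%:~R : zhalf) *:
    hclass (cone_section (hyperbolic R n) (K :\ k) V) = 0.
Proof.
move=> cardK lam0 hV indepK.
have [/exists_inP[k0 k0K lamk0]|/exists_inPn nolam] := boolP [exists k in K, lam k != 0]; last first.
  apply: big1 => k kK; have /eqP -> : lam k == 0 by have := nolam k kK; rewrite negbK.
  by rewrite sgz0 scale0r.
have coord0 (mu : 'I_m -> R) : \sum_(k in K) mu k *: col k V = 0 ->
    (forall k, k \in K -> 0 <= mu k) -> forall k, k \in K -> mu k = 0.
  move=> mu0 mu_ge0 k kK.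
  have /psumr_eq0P mu0' : \sum_(k in K) mu k * V 0 k = 0.
    move/colP: mu0 => /(_ 0); rewrite summxE mxE => mu00; rewrite -[RHS]mu00.
    by apply: eq_bigr => l _; rewrite !mxE.
  have pos l : l \in K -> 0 < V 0 l by move=> /hV[_]; rewrite mxE.
  have /eqP := mu0' (fun l lK => mulr_ge0 (mu_ge0 l lK) (ltW (pos l lK))) k kK.
  by rewrite mulf_eq0 (gt_eqF (pos k kK)) orbF => /eqP.
have some_pos (mu : 'I_m -> R) : \sum_(k in K) mu k *: col k V = 0 ->
    mu k0 != 0 -> exists2 k, k \in K & 0 < mu k.
  move=> mu0 muk0; have [/exists_inP //|/exists_inPn neg] := boolP [exists k in K, 0 < mu k].
  case/eqP: muk0; apply/eqP; rewrite -oppr_eq0; apply/eqP.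
  apply: (coord0 (fun k => - mu k)) => //.
    by under eq_bigr do rewrite scaleNr; rewrite sumrN mu0 oppr0.
  by move=> k /neg; rewrite -leNgt oppr_ge0.
apply: flip => //.
- by move=> k /hV/hyperbolic_meets_ray.
- exact: some_pos.
- have [||k kK] := some_pos (fun k => - lam k); rewrite ?oppr_eq0 //.
    by under eq_bigr do rewrite scaleNr; rewrite sumrN lam0 oppr0.
  by rewrite oppr_gt0; exists k.
Qed.

Lemma orientation_odd d (x : 'M[R]_d.+1) : odd d -> orientation x = (sgz (\det x))%:~R.
Proof. by rewrite /orientation => ->. Qed.

Lemma sign_orientation d (k : nat) (x : 'M[R]_d.+1) : odd d ->
  (-1) ^+ k * orientation x = (sgz ((-1) ^+ k * \det x))%:~R.
Proof.
move=> d_odd; rewrite orientation_odd // sgzM intrM; congr (_ * _).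
by elim: k => [|k IH]; rewrite ?expr0 ?sgz1 // !exprS sgzM sgzN sgz1 intrM -IH.
Qed.

(** By Cramer's rule the orientations of the faces are the signs of the
    coefficients of the linear relation between the [d + 2] points. *)
Lemma oriented_class_cocycle d (W : 'M[R]_(d.+1, d.+2)) : odd d ->
  (forall k, hyperbolic R d (col k W)) ->
  \sum_(k < d.+2) (-1) ^+ k *: oriented_class (col' k W) = 0.
Proof.
move=> d_odd hW.
rewrite -[RHS](@hyperbolic_flip d _ W finset.setT (fun k : 'I_d.+2 => (-1) ^+ k * \det (col' k W))) //.
- rewrite [RHS](eq_bigl xpredT) => [|k]; last by rewrite inE.
  apply: eq_bigr => k _; rewrite /oriented_class scalerA sign_orientation //.
  congr (_ *: hclass (_ `&` _)); rewrite -cone_col'; congr cone.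
  by apply/finset.setP => j; rewrite !inE.
- by rewrite cardsT card_ord.
- by rewrite -[RHS](cramer_relation W); apply: eq_bigl => k; rewrite inE.
- move=> k _; rewrite mulf_eq0 negb_or => /andP[_]; exact: independent_col'.
Qed.

Section OrientedDehn.
Variables (d i m : nat) (dim_sum : d = (i + m).+1) (d_odd : odd d).
Local Notation mxA := 'M[R]_(d.+1, i.+1).
Local Notation mxB := 'M[R]_(d.+1, m.+1).

Definition frame_of (P : 'M[R]_d.+1) : set (mxA * mxB) :=
  [set AB | frame AB.1 AB.2 /\ projector AB.1 = P].

Definition framed (P : 'M[R]_d.+1) := exists AB, frame_of P AB.

Definition fixed p (P : 'M[R]_d.+1) (Y : 'M[R]_(d.+1, p)) : {set 'I_p} :=
  [set k | P *m col k Y == col k Y]%SET.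

(** The part of the Dehn invariant of the oriented simplex [Y] that belongs to
    the subspace onto which [P] projects, for arbitrary columns of [Y]. *)
Definition oriented_dehn (P : 'M[R]_d.+1) (Y : 'M[R]_d.+1) : tensor (PH R i) (PS R m) :=
  if `[< framed P >] && (#|fixed P Y| == i.+1) then
    let AB := xget (0, 0) (frame_of P) in
    orientation Y *: dehn_term Y (fixed P Y) AB.1 AB.2
  else 0.

(** If the columns are dependent both sides vanish with the orientation, so
    [dehn_term_frame] applies. *)
Lemma oriented_dehnE (A : mxA) (B : mxB) (Y : 'M[R]_d.+1) :
  frame A B -> #|fixed (projector A) Y| = i.+1 ->
  (forall k, k \in fixed (projector A) Y -> hyperbolic R d (col k Y)) ->
  oriented_dehn (projector A) Y =
    orientation Y *: dehn_term Y (fixed (projector A) Y) A B.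
Proof.
move=> AB cardF hY; rewrite /oriented_dehn cardF eqxx andbT.
have fA : framed (projector A) by exists (A, B).
rewrite asboolT //; have [AB' PE] := xgetPex (0, 0) fA.
have [Yu|] := boolP (Y \in unitmx); last first.
  rewrite unitmx_det negbK => /eqP Y0.
  by rewrite orientation_odd // Y0 sgz0 !scale0r.
congr (_ *: _); apply: (dehn_term_frame dim_sum AB AB') => //.
by move=> k; rewrite inE => /eqP.
Qed.

Lemma fixed_col' p (P : 'M[R]_d.+1) (W : 'M[R]_(d.+1, p.+1)) k :
  fixed P (col' k W) = [set j | lift k j \in fixed P W]%SET.
Proof. by apply/finset.setP => j; rewrite !inE col_col'. Qed.

Lemma oriented_dehn_card (P Y : 'M[R]_d.+1) : #|fixed P Y| != i.+1 -> oriented_dehn P Y = 0.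
Proof. by rewrite /oriented_dehn => /negPf ->; rewrite andbF. Qed.

(** For [i + 1] columns in the subspace, this is the cocycle relation for the
    spherical factor; for [i + 2] columns, that for the hyperbolic factor. In
    all other cases every term vanishes. *)
Lemma oriented_dehn_cocycle (P : 'M[R]_d.+1) (W : 'M[R]_(d.+1, d.+2)) :
  (forall k, k \in fixed P W -> hyperbolic R d (col k W)) ->
  \sum_(k < d.+2) (-1) ^+ k *: oriented_dehn P (col' k W) = 0.
Proof.
move=> hW; set F := fixed P W.
have [[[A B] [/= AB PA]]|nframed] := pselect (framed P); last first.
  by apply: big1 => k _; rewrite /oriented_dehn asboolF // scaler0.
pose lam (k : 'I_d.+2) := (-1) ^+ k * \det (col' k W).
have indepW k : lam k != 0 -> independent ([set: 'I_d.+2] :\ k)%SET W.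
  by rewrite mulf_eq0 negb_or => /andP[_]; exact: independent_col'.
have cardF k : #|fixed P (col' k W)| = #|F :\ k| by rewrite fixed_col' card_lift.
have fixF k : k \in F -> projector A *m col k W = col k W.
  by rewrite inE PA => /eqP.
have termE k : #|F :\ k| = i.+1 -> (-1) ^+ k *: oriented_dehn P (col' k W) =
    ((sgz (lam k))%:~R : zhalf) *:
    tens (hclass (cone_section (hyperbolic R i) (F :\ k) (coordA A *m W)))
         (sclass (cone_section (usphere R m) (~: F :\ k) (coordB B *m W))).
  move=> cardFk; rewrite -PA (oriented_dehnE AB); last 2 first.
  - by rewrite PA cardF.
  - by move=> j; rewrite PA fixed_col' inE col_col'; exact: hW.
  rewrite PA scalerA sign_orientation //; congr (_ *: _).
  rewrite /dehn_term -!/(coordA _) -!/(coordB _) !mul_col' fixed_col'.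
  rewrite /cone_section cone_col'; congr (tens _ (sclass (_ `&` _))).
  by rewrite -cone_col'; congr cone; apply/finset.setP => j; rewrite !inE.
have termE0 k : #|F :\ k| != i.+1 -> (-1) ^+ k *: oriented_dehn P (col' k W) = 0.
  by move=> cardFk; rewrite oriented_dehn_card ?scaler0 // cardF.
have [cF|cF] := eqVneq #|F| i.+1.
  rewrite (bigID (mem F)) /= [X in X + _]big1 ?add0r => [|k kF]; last first.
    by apply: termE0; have := cardsD1 k F; rewrite kF cF add1n => -[<-]; rewrite neq_ltn ltnSn.
  transitivity (tens (hclass (cone_section (hyperbolic R i) F (coordA A *m W)))
    (\sum_(k in ~: F) ((sgz (lam k))%:~R : zhalf) *:
       sclass (cone_section (usphere R m) (~: F :\ k) (coordB B *m W)))).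
    rewrite tens_sumr; apply: eq_big => k; first by rewrite finset.in_setC.
    by move=> kF; rewrite termE setD1_notin_id // tensZr.
  rewrite sphere_flip ?tens0r //.
  - by have := cardsC F; rewrite card_ord cF; lia.
  - have := congr1 (mulmx (coordB B)) (cramer_relation W).
    rewrite mulmx0 mulmx_sumr (bigID (mem F)) /= [X in X + _]big1 ?add0r => [BW|k kF].
      by rewrite -[RHS]BW; apply: eq_big => k; rewrite ?finset.in_setC // -scalemxAr col_mul.
    by rewrite -scalemxAr -(fixF k kF) mulmxA (coordB_projector AB) mul0mx scaler0.
  - move=> k; rewrite finset.in_setC => kF; apply: contraNneq kF => Bk.
    rewrite inE -PA -[eqbRHS]mul1mx -(frame_complete dim_sum AB) mulmxDl -mulmxA.
    by rewrite -[_ *m col k W in X in _ == _ + _ *m X]col_mul Bk mulmx0 addr0.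
  - move=> k; rewrite finset.in_setC => kF lamk; apply: (coordB_independent dim_sum (I := F) AB) => //.
      by rewrite -finset.setI_eq0 finset.setIDA finset.setICr finset.set0D.
    apply: independentS (indepW k lamk); apply/fintype.subsetP => l.
    rewrite finset.in_setU !in_setD1 finset.in_setC finset.in_setT andbT.
    by case: (eqVneq l k) => [->|//]; rewrite (negPf kF).
have [cF'|cF'] := eqVneq #|F| i.+2; last first.
  apply: big1 => k _; apply: termE0; apply/eqP => cDk; move: cF cF'.
  by rewrite (cardsD1 k F) cDk; case: (k \in F); rewrite eqxx.
rewrite (bigID (mem F)) /= [X in _ + X]big1 ?addr0 => [|k kF]; last first.
  by apply: termE0; rewrite setD1_notin_id.
transitivity (tens (\sum_(k in F) ((sgz (lam k))%:~R : zhalf) *: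
     hclass (cone_section (hyperbolic R i) (F :\ k) (coordA A *m W)))
   (sclass (cone_section (usphere R m) (~: F) (coordB B *m W)))).
  rewrite tens_suml; apply: eq_bigr => k kF; rewrite termE; last first.
    by have := cardsD1 k F; rewrite kF cF' add1n => -[].
  by rewrite [~: F :\ k]setD1_notin_id ?tensZl // finset.in_setC kF.
have indepA k (I : {set 'I_d.+2}) : lam k != 0 -> I \subset F -> k \notin I ->
    independent I (coordA A *m W).
  move=> lamk /fintype.subsetP IF kI; apply: (coordA_independent AB); last first.
    by move=> l /IF/fixF.
  apply: independentS (indepW k lamk); apply/fintype.subsetP => l lI.
  by rewrite !inE andbT; apply: contraNneq kI => <-.
rewrite hyperbolic_flip ?tens0l //.
- have := congr1 (mulmx (coordA A)) (cramer_relation W).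
  rewrite mulmx0 mulmx_sumr (bigID (mem F)) /= [X in _ + X]big1 ?addr0 => [AW|k kF].
    by rewrite -[RHS]AW; apply: eq_bigr => k _; rewrite -scalemxAr col_mul.
  have -> : (-1) ^+ k * \det (col' k W) = 0; last by rewrite scale0r mulmx0.
  (* The [i + 2] columns in [F] lie in a space of dimension [i + 1]. *)
  apply/eqP/negPn/negP => lamk.
  by have := independent_card (indepA k F lamk (subxx _) kF); rewrite cF' ltnn.
- move=> k kF; rewrite col_mul; apply: (coordA_hyperbolic AB); last exact: fixF.
  exact: hW.
- move=> k kF lamk; apply: (indepA k) => //; first exact: subD1set.
  by rewrite !inE eqxx.
Qed.

End OrientedDehn.
End Cocycle.

(** * Equivariance *)

Section Equivariance.
Variables (R : realType).
Local Notation J := (lorentz_mx R).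

(** The sheet sign enters [d + 1] times, an even number. *)
Lemma orientation_lorentz d (g : lorentz R d) (Y : 'M[R]_d.+1) : odd d ->
  orientation (sheet_sign g *: (val g *m Y)) = det_sign g * orientation Y.
Proof.
move=> d_odd; rewrite !orientation_odd // detZ det_mulmx /det_sign.
have -> : sheet_sign g ^+ d.+1 = 1.
  have /even_halfK <- : ~~ odd d.+1 by rewrite /= d_odd.
  by rewrite -mul2n exprM expr2 sheet_sign_sqr expr1n.
by rewrite mul1r sgzM intrM.
Qed.

Lemma oriented_class_lorentz d (g : lorentz R d) (Y : 'M[R]_d.+1) : odd d ->
  (forall k, hyperbolic R d (col k Y)) ->
  oriented_class (sheet_sign g *: (val g *m Y)) = det_sign g *: oriented_class Y.
Proof.
move=> d_odd hY; rewrite /oriented_class orientation_lorentz // scalerA.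
have [Yu|] := boolP (Y \in unitmx); last first.
  rewrite unitmx_det negbK => /eqP Y0.
  by rewrite orientation_odd // Y0 sgz0 mulr0 !scale0r.
congr (_ *: _); apply: hclass_lorentz => //; first by rewrite cardsT card_ord.
exact: unitmx_independent.
Qed.

Definition conjugate d (g : lorentz R d) (P : 'M[R]_d.+1) : 'M[R]_d.+1 :=
  val g *m P *m val g^-1%g.

Lemma lorentz_mulV d (g : lorentz R d) : val g *m val g^-1%g = 1%:M.
Proof. by have /(congr1 val) := mulgV g. Qed.

Lemma lorentz_Vmul d (g : lorentz R d) : val g^-1%g *m val g = 1%:M.
Proof. by have /(congr1 val) := mulVg g. Qed.

Lemma conjugateK d (g : lorentz R d) : cancel (conjugate g) (conjugate g^-1%g).
Proof.
move=> P; rewrite /conjugate invgK; move: (lorentz_Vmul g).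
move: (val g) (val g^-1%g) => M V VM.
by rewrite -!mulmxA VM mulmx1 mulmxA VM mul1mx.
Qed.

Lemma conjugateVK d (g : lorentz R d) : cancel (conjugate g^-1%g) (conjugate g).
Proof. by move=> P; have := conjugateK g^-1%g P; rewrite invgK. Qed.

Lemma lorentz_valM d (g h : lorentz R d) : val (g * h)%g = val g *m val h.
Proof. by []. Qed.

Lemma conjugateM d (g h : lorentz R d) P :
  conjugate (g * h)%g P = conjugate g (conjugate h P).
Proof.
rewrite /conjugate invgM !lorentz_valM.
by move: (val g^-1%g) (val h^-1%g) => V V'; rewrite !mulmxA.
Qed.

Section Frames.
Variables (d i m : nat) (dim_sum : d = (i + m).+1).

Lemma frame_lorentz (g : lorentz R d) (A : 'M[R]_(d.+1, i.+1)) (B : 'M[R]_(d.+1, m.+1)) :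
  frame A B ->
  [/\ frame (sheet_sign g *: (val g *m A)) (sheet_sign g *: (val g *m B)),
      projector (sheet_sign g *: (val g *m A)) = conjugate g (projector A),
      coordA (sheet_sign g *: (val g *m A)) *m (sheet_sign g *: val g) = coordA A &
      coordB (sheet_sign g *: (val g *m B)) *m (sheet_sign g *: val g) = coordB B].
Proof.
move=> AB; have [AA A0 BB A_B] := AB.
have formE p q (M : 'M[R]_(d.+1, p)) (N : 'M[R]_(d.+1, q)) :
    (sheet_sign g *: (val g *m M))^T *m J d *m (sheet_sign g *: (val g *m N)) =
    M^T *m J d *m N.
  move: (lorentzP g) (sheet_sign_sqr g); move: (val g) (sheet_sign g) => h s hJ ss.
  rewrite [(_ *: _)^T]linearZ /= -!scalemxAl -scalemxAr scalerA ss scale1r.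
  by rewrite -[in RHS]hJ trmx_mul !mulmxA.
have gA0 : 0 < (sheet_sign g *: (val g *m A)) 0 0.
  have [gE [_]] := lorentz_actE g (frame_origin AB).
  rewrite gE mulmxA scalemxAl /origin -colE mxE; exact: id.
have frame' : frame (sheet_sign g *: (val g *m A)) (sheet_sign g *: (val g *m B)).
  by split; rewrite ?formE.
have formE1 p (M : 'M[R]_(d.+1, p)) : (sheet_sign g *: (val g *m M))^T *m J d *m
    (sheet_sign g *: val g) = M^T *m J d.
  by rewrite -[val g in X in _ *m X]mulmx1 formE mulmx1.
have coordA' : coordA (sheet_sign g *: (val g *m A)) *m (sheet_sign g *: val g) = coordA A.
  by rewrite /coordA -!mulmxA (mulmxA _ (J d)) formE1.
split=> //; last exact: formE1.
rewrite /conjugate /projector -coordA'; move: (coordA _) (lorentz_mulV g) => X.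
move: (val g) (val g^-1%g) (sheet_sign g) => h V s hV.
rewrite -!scalemxAr -!scalemxAl -!mulmxA hV mulmx1; congr (_ *: _).
Qed.

Lemma framed_conjugate (g : lorentz R d) P :
  framed i m P -> framed i m (conjugate g P).
Proof.
move=> [[A B] [/= AB <-]]; have [AB' PE _ _] := frame_lorentz g AB.
by exists (sheet_sign g *: (val g *m A), sheet_sign g *: (val g *m B)).
Qed.

Lemma fixed_conjugate (g : lorentz R d) p (P : 'M[R]_d.+1) (Y : 'M[R]_(d.+1, p)) :
  fixed (conjugate g P) (sheet_sign g *: (val g *m Y)) = fixed P Y.
Proof.
apply/finset.setP => k; rewrite !inE /conjugate; move: (lorentz_Vmul g) (sheet_sign_neq0 g).
move: (val g) (val g^-1%g) (sheet_sign g) => M V s VM s0.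
rewrite linearZ /= col_mul -scalemxAr -!mulmxA (mulmxA V) VM mul1mx.
apply/eqP/eqP => [|-> //] /(scalerI s0).
by move=> /(congr1 (mulmx V)); rewrite !mulmxA VM !mul1mx.
Qed.

(** The frames of the translated subspace are the translated frames, in which the
    coordinates do not change; only the orientation does. *)
Lemma oriented_dehn_lorentz (g : lorentz R d) (P Y : 'M[R]_d.+1) : odd d ->
  (forall k, k \in fixed P Y -> hyperbolic R d (col k Y)) ->
  oriented_dehn i m (conjugate g P) (sheet_sign g *: (val g *m Y)) =
  det_sign g *: oriented_dehn i m P Y.
Proof.
move=> d_odd hY.
have [cardF|cardF] := eqVneq #|fixed P Y| i.+1; last first.
  by rewrite !oriented_dehn_card ?scaler0 // fixed_conjugate.
have [[[A B] [/= AB PA]]|nframed] := pselect (framed i m P); last first.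
  rewrite /oriented_dehn !asboolF ?scaler0 //= => /(framed_conjugate g^-1%g).
  by rewrite conjugateK.
have [AB' PA' cA cB] := frame_lorentz g AB.
rewrite -PA -PA' (oriented_dehnE dim_sum d_odd AB') PA' ?fixed_conjugate; last 2 first.
- by rewrite PA.
- move=> k; rewrite PA => kF; rewrite linearZ /= col_mul.
  by have [<-] := lorentz_actE g (hY k kF).
rewrite (oriented_dehnE dim_sum d_odd AB) ?PA // orientation_lorentz // scalerA.
congr (_ *: _); rewrite /dehn_term -!/(coordA _) -!/(coordB _).
rewrite [sheet_sign g *: (val g *m Y)]scalemxAl.
by rewrite !mulmxA cA cB.
Qed.

(** * Existence and uniqueness of frames *)

(** A set of [i + 1] independent vectors spans a unique subspace, and a
    Lorentz orthogonal projector is determined by its image. *)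
Lemma projector_unique (A A' : 'M[R]_(d.+1, i.+1)) (B B' : 'M[R]_(d.+1, m.+1))
    p (Y : 'M[R]_(d.+1, p)) (I : {set 'I_p}) :
  frame A B -> frame A' B' -> #|I| = i.+1 -> independent I Y ->
  (forall k, k \in I -> projector A *m col k Y = col k Y) ->
  (forall k, k \in I -> projector A' *m col k Y = col k Y) ->
  projector A = projector A'.
Proof.
move=> AB AB' cardI indepY.
have absorb (C C' : 'M[R]_(d.+1, i.+1)) (D D' : 'M[R]_(d.+1, m.+1)) :
    frame C D -> frame C' D' ->
    (forall k, k \in I -> projector C *m col k Y = col k Y) ->
    (forall k, k \in I -> projector C' *m col k Y = col k Y) ->
    projector C' *m projector C = projector C.
  move=> CD CD' fixC fixC'.
  have [k0 k0I] : exists k, k \in I by apply/set0Pn; rewrite -card_gt0 cardI.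
  have [e eI _] := exists_enumeration cardI k0I.
  have bu := independent_unitmx eI (coordA_independent CD indepY fixC).
  have fix_cols (M : 'M[R]_d.+1) : (forall k, k \in I -> M *m col k Y = col k Y) ->
      M *m colsub e Y = colsub e Y.
    move=> fixM; apply/matrixP => r j; have /colP/(_ r) := fixM _ (enumerates_in j eI).
    by rewrite !mxE => <-; apply: eq_bigr => l _; rewrite !mxE.
  have CY : C *m colsub e (coordA C *m Y) = colsub e Y.
    rewrite -[RHS](fix_cols _ fixC) /projector -mulmxA; congr (_ *m _).
    by apply/matrixP => r j; rewrite !mxE; apply: eq_bigr => l _; rewrite !mxE.
  have CE : C = colsub e Y *m invmx (colsub e (coordA C *m Y)).
    by rewrite -CY mulmxK.
  have C'C : projector C' *m C = C by rewrite CE mulmxA fix_cols.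
  by rewrite {1 3}/projector mulmxA C'C.
move=> fixA fixA'; have PP' := absorb _ _ _ _ AB AB' fixA fixA'.
have P'P := absorb _ _ _ _ AB' AB fixA' fixA.
have adj (C : 'M[R]_(d.+1, i.+1)) : (projector C)^T *m J d = J d *m projector C.
  by rewrite /projector /coordA !trmx_mul trmxK !lorentz_mx_tr !mulmxA.
have JPP' : J d *m projector A = J d *m projector A'.
  by rewrite -PP' mulmxA -adj -mulmxA -adj mulmxA -trmx_mul P'P.
by rewrite -[LHS]mul1mx -[RHS]mul1mx -(lorentz_mxK R d) -!mulmxA JPP'.
Qed.

(** One step of Gaussian elimination clears the first row and column of [S]; the
    Schur complement is again positive definite. *)
Lemma posdef_congruent_one k (S : 'M[R]_k) : S^T = S ->
  (forall y : 'cV_k, y != 0 -> 0 < (y^T *m S *m y) 0 0) ->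
  exists2 T : 'M[R]_k, T \in unitmx & T^T *m S *m T = 1%:M.
Proof.
elim: k S => [|k IH] S symS posS.
  by exists 1%:M; rewrite ?unitmx1 // [LHS]flatmx0 [RHS]flatmx0.
pose S2 : 'M[R]_(1 + k) := S; pose a := S2 0 0.
have [r rE] : exists r : 'M[R]_(1, k), r = ursubmx S2 by exists (ursubmx S2).
have S2E : S2 = block_mx a%:M r r^T (drsubmx S2).
  rewrite -[LHS]submxK rE; congr block_mx.
    by apply/matrixP => s t; rewrite !ord1 !mxE /= mulr1n; congr (S _ _); exact: val_inj.
  by rewrite -[in LHS](_ : S2^T = S2) // trmx_ursub.
have a0 : 0 < a.
  have := posS (delta_mx 0 0); rewrite /a /S2.
  rewrite (_ : (_ *m _ *m _) 0 0 = S 0 0).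
    by apply; apply/eqP => /matrixP/(_ 0 0); rewrite !mxE !eqxx => /eqP; rewrite oner_eq0.
  by rewrite trmx_delta -rowE -colE !mxE.
pose E : 'M[R]_(1 + k) := block_mx 1%:M (- a^-1 *: r) 0 1%:M.
pose S' := drsubmx S2 - a^-1 *: (r^T *m r).
have ES : E^T *m S2 *m E = block_mx a%:M 0 0 S'.
  rewrite S2E /E tr_block_mx !mulmx_block !trmx1 !trmx0 !linearZ /=.
  rewrite !mul1mx !mul0mx !mulmx1 !mulmx0 !addr0 ?add0r.
  have aV : - a^-1 * a = -1 by rewrite mulNr mulVf // gt_eqF.
  rewrite mul_scalar_mx mul_mx_scalar !scalerA [a * _]mulrC aV !scaleN1r !addNr.
  by rewrite mul0mx scaler0 add0r -scalemxAl scaleNr addrC.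
have Eu : E \in unitmx by rewrite unitmxE det_ublock !det1 mulr1 unitr1.
have [||T' T'u T'S] := IH S'.
- rewrite /S' linearB linearZ /= trmx_mul trmxK; congr (_ - _).
  by rewrite trmx_drsub (_ : S2^T = S2).
- move=> y y0; pose z : 'cV[R]_(1 + k) := E *m col_mx 0 y.
  have : z != 0.
    apply: contraNneq y0 => z0.
    have : col_mx 0 y = col_mx 0 0 :> 'cV_(1 + k).
      by rewrite -[LHS](mulKmx Eu) -/z z0 mulmx0 col_mx0.
    by move=> /eq_col_mx[_ ->].
  move=> /posS; rewrite -/S2 /z trmx_mul -!mulmxA (mulmxA S2) (mulmxA E^T) (mulmxA _ S2) ES.
  by rewrite mul_block_col tr_col_mx mul_row_col !mulmx0 !mul0mx trmx0 mul0mx !add0r mulmxA.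
pose D : 'M[R]_(1 + k) := block_mx (Num.sqrt a)^-1%:M 0 0 T'.
have Du : D \in unitmx.
  rewrite unitmxE det_ublock det_scalar1 unitrM -unitmxE T'u andbT.
  by rewrite unitfE invr_eq0 gt_eqF // sqrtr_gt0.
have EDS : (E *m D)^T *m S2 *m (E *m D) = 1%:M.
  rewrite trmx_mul -!mulmxA (mulmxA _ E) (mulmxA E^T) (mulmxA E^T) ES /D tr_block_mx.
  rewrite !mulmx_block tr_scalar_mx !trmx0 !(mul0mx, mulmx0, addr0, add0r).
  rewrite [T'^T *m _]mulmxA T'S -!scalar_mxM mulrCA -invfM -expr2 sqr_sqrtr ?ltW //.
  by rewrite mulfV ?gt_eqF // -scalar_mx_block.
by exists (E *m D); first by rewrite unitmx_mul Eu Du.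
Qed.

End Frames.
End Equivariance.

Section FrameExistence.
Variables (R : realType).
Local Notation J := (lorentz_mx R).

Lemma orthonormal_basis d p (V : 'M[R]_(d.+1, p)) :
  (forall y : 'cV_p, y != 0 -> 0 < lform (V *m y) (V *m y)) ->
  exists2 T : 'M[R]_p, T \in unitmx & (V *m T)^T *m J d *m (V *m T) = 1%:M.
Proof.
move=> posV; have [||T Tu TS] := @posdef_congruent_one R p (V^T *m J d *m V).
- by rewrite !trmx_mul trmxK lorentz_mx_tr mulmxA.
- by move=> y /posV; rewrite lform_mul.
by exists T; rewrite // -[RHS]TS trmx_mul !mulmxA.
Qed.

Lemma lorentz_mx_block i : J i = block_mx (-1)%:M 0 0 1%:M :> 'M[R]_(1 + i).
Proof.
apply/matrixP => s t; rewrite !mxE.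
case: (split_ordP s) => s' ->; rewrite !mxE; case: (split_ordP t) => t' ->;
  rewrite !mxE ?ord1 ?(inj_eq (@lshift_inj _ _)) ?(inj_eq (@rshift_inj _ _)) ?eq_lrshift ?eq_rlshift //.
Qed.

Section GramSchmidt.
Variables (d i : nat) (u : 'cV[R]_d.+1) (X : 'M[R]_(d.+1, i)).
Hypotheses (hu : hyperbolic R d u)
  (freeX : forall y : 'cV_(1 + i), row_mx u X *m y = 0 -> y = 0).

(** The timelike vector [u] is kept, and the columns of [X] are made orthogonal to
    it; the form is positive definite on what they span, so that an orthonormal
    basis exists there. *)
Lemma lorentz_gram_schmidt :
  exists (A : 'M[R]_(d.+1, i.+1)) (M N : 'M[R]_(i.+1)),
    [/\ A^T *m J d *m A = J i, col 0 A = u, A = (row_mx u X : 'M[R]_(d.+1, i.+1)) *m M &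
        row_mx u X = A *m N].
Proof.
pose l : 'M[R]_(1, i) := u^T *m J d *m X.
pose V := X + u *m l.
have uu : u^T *m J d *m u = (-1)%:M.
  by apply/matrixP => s t; rewrite !ord1 [RHS]mxE eqxx mulr1n; have [] := hu.
have uV : u^T *m J d *m V = 0.
  by rewrite /V mulmxDr -/l mulmxA uu mul_scalar_mx scaleN1r subrr.
have posV (y : 'cV_i) : y != 0 -> 0 < lform (V *m y) (V *m y).
  move=> y0; apply: (lform_orthogonal_gt0 hu).
    by rewrite /lform mulmxA uV mul0mx mxE.
  apply: contraNneq y0 => Vy0.
  have : row_mx u X *m col_mx (l *m y) y = 0.
    by rewrite mul_row_col addrC -[RHS]Vy0 /V mulmxDl mulmxA.
  by move=> /freeX; rewrite -[X in _ = X]col_mx0 => /eq_col_mx[_ ->].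
have [T Tu VT] := orthonormal_basis posV.
pose M : 'M[R]_(1 + i) := block_mx 1%:M (l *m T) 0 T.
have Mu : M \in unitmx by rewrite unitmxE det_ublock det1 mul1r -unitmxE.
have XM : row_mx u X *m M = row_mx u (V *m T).
  by rewrite mul_row_block !mulmx1 mulmx0 addr0 /V mulmxDl mulmxA addrC.
have AA : (row_mx u (V *m T))^T *m J d *m row_mx u (V *m T) = J i :> 'M[R]_(1 + i).
  rewrite (lorentz_mx_block i) tr_row_mx mul_col_mx mul_col_row uu VT.
  have -> : u^T *m J d *m (V *m T) = 0 by rewrite mulmxA uV mul0mx.
  have -> // : (V *m T)^T *m J d *m u = 0.
  have := congr1 trmx uV; rewrite !trmx_mul trmxK lorentz_mx_tr trmx0 => Vu.
  by rewrite -!mulmxA Vu mulmx0.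
exists (row_mx u (V *m T)), M, (invmx M); split; first exact: AA.
- apply/colP => r; rewrite mxE (_ : 0 = lshift i (0 : 'I_1)); last exact: val_inj.
  exact: (@row_mxEl _ _ 1 i).
- by rewrite -XM.
- by rewrite -XM mulmxK.
Qed.

End GramSchmidt.

Lemma colsub_complement n p q r (e : 'I_p -> 'I_r) (e' : 'I_q -> 'I_r)
    (Y : 'M[R]_(n.+1, r)) (I : {set 'I_r}) (z : 'cV[R]_p) (y : 'cV[R]_q) :
  enumerates e I -> enumerates e' (~: I) -> independent finset.setT Y ->
  colsub e' Y *m y = colsub e Y *m z -> y = 0.
Proof.
move=> eI eC indepY; have [einj _] := eI; have [e'inj _] := eC.
rewrite !mulmx_sum_col => yz.
pose c k := if k \in I then - \sum_(j | e j == k) z j 0 else \sum_(j | e' j == k) y j 0.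
have c0 : forall k, k \in [set: 'I_r]%SET -> c k = 0.
  apply: indepY; rewrite (bigID (mem I)) /=; apply/eqP; rewrite addrC addr_eq0; apply/eqP.
  rewrite (eq_bigl (fun k => k \in ~: I)) => [|k]; last by rewrite !inE.
  rewrite [in RHS](eq_bigl (fun k => k \in I)) => [|k]; last by rewrite !inE.
  rewrite (enumerates_sum _ eC) (enumerates_sum _ eI) -sumrN.
  transitivity (\sum_j y j 0 *: col j (colsub e' Y)).
    apply: eq_bigr => j _; have := enumerates_in j eC; rewrite inE /c => /negPf ->.
    by rewrite col_colsub (big_pred1 j) // => j'; exact: inj_eq.
  rewrite yz; apply: eq_bigr => j _; rewrite /c (enumerates_in j eI) scaleNr opprK.
  by rewrite col_colsub (big_pred1 j) // => j'; exact: inj_eq.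
apply/colP => j; rewrite mxE -(c0 (e' j) (finset.in_setT _)) /c.
have := enumerates_in j eC; rewrite inE => /negPf ->.
by rewrite (big_pred1 j) // => j'; exact: inj_eq.
Qed.

(** The columns in [I] contain a timelike vector, so they have an orthonormal
    basis of Lorentz type, and their orthogonal is positive definite. A further
    column fixed by the projector would give [i + 2] independent vectors in
    dimension [i + 1]. *)
Lemma exists_frame d i m (Y : 'M[R]_d.+1) (I : {set 'I_d.+1}) : d = (i + m).+1 ->
  Y \in unitmx -> (forall k, hyperbolic R d (col k Y)) -> #|I| = i.+1 ->
  exists (A : 'M[R]_(d.+1, i.+1)) (B : 'M[R]_(d.+1, m.+1)),
    frame A B /\ fixed (projector A) Y = I.
Proof.
move=> dim_sum Yu hY cardI; have indepY := unitmx_independent Yu.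
have indepS (I' : {set 'I_d.+1}) : independent I' Y.
  exact: independentS (finset.subsetT _) indepY.
have [k0 k0I] : exists k, k \in I by apply/set0Pn; rewrite -card_gt0 cardI.
have [e eI _] := exists_enumeration cardI k0I.
pose u := col (e 0) Y; pose X := colsub (e \o lift 0) Y.
have XE : row_mx u X = colsub e Y :> 'M[R]_(d.+1, 1 + i).
  apply/matrixP => r j; case: (split_ordP j) => j' ->.
    by rewrite row_mxEl ord1 !mxE; congr (Y _ (e _)); exact: val_inj.
  by rewrite row_mxEr !mxE /=; congr (Y _ (e _)); exact: val_inj.
have [|A [M [N [AA A_u AM AN]]]] := lorentz_gram_schmidt (hY (e 0)) (X := X).
  by move=> y; rewrite XE; exact: colsub_mulK eI (indepS I).
pose P := projector A.
have PA : P *m A = A by rewrite /P /projector /coordA -!mulmxA (mulmxA A^T) AA lorentz_mxK mulmx1.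
have fixI k : k \in I -> P *m col k Y = col k Y.
  have [_ ->] := eI => /imsetP[j _ ->].
  have -> : col (e j) Y = A *m col j N.
    by rewrite -col_mul -(etrans (esym XE) AN : colsub e Y = A *m N) col_colsub.
  by rewrite mulmxA PA.
have cardC : #|~: I| = m.+1 by have := cardsC I; rewrite card_ord cardI; lia.
have [k1 k1I] : exists k, k \in ~: I by apply/set0Pn; rewrite -card_gt0 cardC.
have [e' eC _] := exists_enumeration cardC k1I.
pose V := (1%:M - P) *m colsub e' Y.
have AV : A^T *m J d *m V = 0.
  rewrite /V mulmxA mulmxBr mulmx1 /P /projector /coordA !mulmxA AA.
  by rewrite lorentz_mxK mul1mx subrr mul0mx.
have posV (y : 'cV_m.+1) : y != 0 -> 0 < lform (V *m y) (V *m y).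
  move=> y0; apply: (lform_orthogonal_gt0 (hY (e 0))).
    rewrite -A_u /lform mulmxA.
    have -> : (col 0 A)^T *m J d *m V = 0; last by rewrite mul0mx mxE.
    by rewrite tr_col -!row_mul AV row0.
  apply: contraNneq y0; rewrite /V mulmxBl mul1mx mulmxBl => /eqP.
  rewrite subr_eq0 {1}/P /projector -!mulmxA {1}AM -mulmxA => /eqP Yy.
  by apply/eqP/(colsub_complement eI eC indepY); rewrite {1}Yy -XE.
have [T Tu VT] := orthonormal_basis posV.
have AB : frame A (V *m T).
  split => //; last by rewrite mulmxA AV mul0mx.
  have [_] := hY (e 0); rewrite -A_u mxE; exact: id.
exists A, (V *m T); split=> //; apply/finset.setP => k; rewrite inE.
apply/eqP/idP => [fixk|]; last exact: fixI.
apply/negPn/negP => kI.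
have fixkI l : l \in k |: I -> projector A *m col l Y = col l Y.
  by rewrite in_setU1 => /orP[/eqP->|/fixI].
have := independent_card (coordA_independent AB (indepS _) fixkI).
by rewrite cardsU1 kI cardI ltnn.
Qed.

End FrameExistence.

(** * The Dehn cochain *)

Lemma col_scale_mul (R : realType) p q r (a : R) (A : 'M[R]_(p, q)) (B : 'M[R]_(q, r)) k :
  col k (a *: (A *m B)) = a *: (A *m col k B).
Proof. by rewrite linearZ /= col_mul. Qed.

Section FiniteSums.
Variables (k : nzRingType) (M : lmodType k) (I : choiceType).

Lemma fsum_cover (s : seq I) (F : I -> M) : (forall P, F P != 0 -> P \in s) ->
  \sum_(P \in [set: I]) F P = \sum_(P <- undup s) F P.
Proof.
move=> Fs; rewrite -(fsbig_fwiden (undup s) [set` undup s]) ?undup_uniq //.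
  apply/esym/fsbig_widen => // P [_ /= Ps].
  by apply/eqP; apply: contra_notT Ps => /Fs; rewrite mem_undup.
by move=> P [].
Qed.

Lemma fsum_exchange n (a : 'I_n -> k) (F : 'I_n -> I -> M) :
  (forall q, exists s : seq I, forall P, F q P != 0 -> P \in s) ->
  \sum_q a q *: \sum_(P \in [set: I]) F q P =
  \sum_(P \in [set: I]) \sum_q a q *: F q P.
Proof.
move=> /choice[s sF]; pose t := flatten [seq s q | q <- enum 'I_n].
have tF q P : F q P != 0 -> P \in t.
  by move=> /sF Ps; apply/flatten_mapP; exists q; rewrite ?mem_enum.
rewrite (@fsum_cover t) => [|P]; last first.
  apply: contraNT => Pt; rewrite big1 // => q _.
  by have [->|/tF] := eqVneq (F q P) 0; [rewrite scaler0 | rewrite (negPf Pt)].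
rewrite exchange_big /=; apply: eq_bigr => q _.
by rewrite (fsum_cover (tF q)) scaler_sumr.
Qed.

Lemma fsum_scale (a : k) (F : I -> M) :
  (exists s : seq I, forall P, F P != 0 -> P \in s) ->
  a *: \sum_(P \in [set: I]) F P = \sum_(P \in [set: I]) a *: F P.
Proof.
move=> Fs; have := @fsum_exchange 1 (fun=> a) (fun=> F) (fun=> Fs).
rewrite big_ord1 => ->; apply: eq_fsbigr => P _; exact: big_ord1.
Qed.

End FiniteSums.

Section DehnCochain.
Variables (R : realType) (n i m : nat).
Local Notation d := n.+1.
Hypotheses (dim_sum : d = (i + m).+1) (d_odd : odd d).
Variables (x0 : 'cV[R]_d.+1) (hx0 : hyperbolic R d x0).
Local Notation G := (lorentz R d).

Definition orbit_point (g : G) : 'cV[R]_d.+1 := lorentz_act g x0.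

Lemma orbit_point_hyperbolic g : hyperbolic R d (orbit_point g).
Proof. exact: lorentz_act_hyperbolic. Qed.

Lemma orbit_pointM g h :
  orbit_point (g * h)%g = sheet_sign g *: (val g *m orbit_point h).
Proof.
rewrite /orbit_point lorentz_actM //.
by have [] := lorentz_actE g (orbit_point_hyperbolic h).
Qed.

Definition moved_by (P : 'M[R]_d.+1) : set 'cV[R]_d.+1 := [set a | P *m a <> a].

(** The choice is made for [g^-1 P g] and then moved by [g]. It thus follows every
    simultaneous translation of [P] and [g], which a choice depending on [P] alone
    could not do, since [P] has a nontrivial stabiliser. *)
Definition outside_vector (P : 'M[R]_d.+1) (g : G) : 'cV[R]_d.+1 :=
  sheet_sign g *: (val g *m
    xget 0 (moved_by (conjugate g^-1%g P))).

Lemma outside_vectorM P g h :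
  outside_vector (conjugate g P) (g * h)%g =
  sheet_sign g *: (val g *m outside_vector P h).
Proof.
rewrite /outside_vector invgM conjugateM conjugateK sheet_signM lorentz_valM.
by rewrite -scalemxAr scalerA mulmxA.
Qed.

Lemma outside_vectorP P g : framed i m P -> P *m outside_vector P g != outside_vector P g.
Proof.
move=> /(framed_conjugate g^-1%g) [[A B] [/= AB PA]].
have [a Pa] : exists a : 'cV[R]_d.+1, conjugate g^-1%g P *m a <> a.
  exists (B *m delta_mx 0 0); rewrite -PA mulmxA (projectorB AB) mul0mx => B0.
  have := congr1 (mulmx (coordB B)) B0; rewrite mulmx0 mulmxA (coordBB AB) mul1mx.
  by move=> /matrixP/(_ 0 0)/eqP; rewrite !mxE eqxx eq_sym oner_eq0.
have {Pa} := @xgetI _ 0 (moved_by (conjugate g^-1%g P)) a Pa.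
rewrite /outside_vector; move: (xget _ _) => b Pb.
apply/eqP => gb; apply: Pb; move: gb; rewrite /conjugate invgK.
move: (lorentz_Vmul g) (sheet_sign_neq0 g); move: (val g) (val g^-1%g) (sheet_sign g) => M V s VM s0.
rewrite -scalemxAr => /(scalerI s0)/(congr1 (mulmx V)).
by rewrite !mulmxA VM mul1mx.
Qed.

(** Vertices of the prism: [(g, true)] stands for the point [g x_0], and
    [(g, false)] for its substitute [outside_vector P g], which is only used
    where [g x_0] lies in the image of [P]. *)
Definition vertex_vector (P : 'M[R]_d.+1) (v : G * bool) : 'cV[R]_d.+1 :=
  if v.2 || (P *m orbit_point v.1 != orbit_point v.1) then orbit_point v.1
  else outside_vector P v.1.

Definition vertex_mx p (P : 'M[R]_d.+1) (v : nat -> G * bool) : 'M[R]_(d.+1, p) :=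
  \matrix_(r < d.+1, k < p) vertex_vector P (v k) r 0.

Lemma col_vertex_mx p P v k : col k (vertex_mx p P v) = vertex_vector P (v k).
Proof. by apply/colP => r; rewrite !mxE. Qed.

Definition dehn_part (P : 'M[R]_d.+1) (v : nat -> G * bool) : tensor (PH R i) (PS R m) :=
  oriented_dehn i m P (vertex_mx d.+1 P v).

Definition dehn_cochain (v : nat -> G * bool) : tensor (PH R i) (PS R m) :=
  \sum_(P \in [set: 'M[R]_d.+1]) dehn_part P v.

Lemma fixed_vertex p P v k : framed i m P -> k \in fixed P (vertex_mx p P v) ->
  [/\ (v k).2, vertex_vector P (v k) = orbit_point (v k).1 &
      P *m orbit_point (v k).1 = orbit_point (v k).1].
Proof.
move=> fP; rewrite inE col_vertex_mx /vertex_vector.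
case: ((v k).2) => /= [/eqP //|]; case: ifP => [/negPf -> //|_].
by rewrite (negPf (outside_vectorP _ fP)).
Qed.

Lemma fixed_vertex_hyperbolic p P v k : framed i m P ->
  k \in fixed P (vertex_mx p P v) -> hyperbolic R d (col k (vertex_mx p P v)).
Proof.
move=> fP /(fixed_vertex fP)[_ vE _]; rewrite col_vertex_mx vE.
exact: orbit_point_hyperbolic.
Qed.

Lemma dehn_part_nframed P v : ~ framed i m P -> dehn_part P v = 0.
Proof. by move=> nP; rewrite /dehn_part /oriented_dehn asboolF. Qed.

Lemma dehn_part_neq0 P v : dehn_part P v != 0 ->
  [/\ framed i m P, #|fixed P (vertex_mx d.+1 P v)| = i.+1 &
      vertex_mx d.+1 P v \in unitmx].
Proof.
rewrite /dehn_part /oriented_dehn; case: ifP => [/andP[/asboolP fP /eqP cardF]|]; last by rewrite eqxx.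
rewrite unitmx_det => Tneq0; split=> //; apply: contraNneq Tneq0 => Y0.
by rewrite orientation_odd // Y0 sgz0 scale0r.
Qed.

(** A subspace that contributes is spanned by the points of a subset of the
    vertices, of which there are finitely many. *)
Lemma dehn_part_support v :
  exists s : seq 'M[R]_d.+1, forall P, dehn_part P v != 0 -> P \in s.
Proof.
pose f (I : {set 'I_d.+1}) := xget 0 [set P | framed i m P /\
  forall k, k \in I -> P *m orbit_point (v k).1 = orbit_point (v k).1].
exists [seq f J | J <- enum {set 'I_d.+1}] => P /dehn_part_neq0[fP cardF Yu].
set Y := vertex_mx _ _ _ in cardF Yu; apply/mapP; exists (fixed P Y); first by rewrite mem_enum.
have Pfix k : k \in fixed P Y -> P *m orbit_point (v k).1 = orbit_point (v k).1.
  by move=> /(fixed_vertex fP)[].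
have [] := @xgetI _ 0 [set P' | framed i m P' /\
  forall k, k \in fixed P Y -> P' *m orbit_point (v k).1 = orbit_point (v k).1] P (conj fP Pfix).
rewrite -/(f (fixed P Y)); move: (f _) => P' [[A' B'] [/= AB' PA']] Pfix'.
have [[A B] [/= AB PA]] := fP.
rewrite -PA -PA'; apply: (projector_unique AB AB' cardF).
- exact: independentS (finset.subsetT _) (unitmx_independent Yu).
- by move=> k; rewrite PA inE => /eqP.
- move=> k kF; have [_ vE _] := fixed_vertex fP kF.
  by rewrite PA' col_vertex_mx vE Pfix'.
Qed.

Definition translate (g : G) (v : G * bool) : G * bool := ((g * v.1)%g, v.2).

Lemma vertex_vector_translate P g v :
  vertex_vector (conjugate g P) (translate g v) =
  sheet_sign g *: (val g *m vertex_vector P v).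
Proof.
case: v => h b; rewrite /vertex_vector /= orbit_pointM outside_vectorM.
have -> : (conjugate g P *m (sheet_sign g *: (val g *m orbit_point h)) ==
    sheet_sign g *: (val g *m orbit_point h)) = (P *m orbit_point h == orbit_point h).
  have := @fixed_conjugate _ _ g 1 P (orbit_point h).
  move=> /finset.setP/(_ 0); rewrite !inE => e.
  have colE (w : 'cV[R]_d.+1) : col 0 w = w by apply/colP => r; rewrite mxE.
  by rewrite !colE in e.
by case: ifP.
Qed.

Lemma dehn_part_translate P g v :
  dehn_part (conjugate g P) (translate g \o v) = det_sign g *: dehn_part P v.
Proof.
have [fP|nfP] := pselect (framed i m P); last first.
  rewrite !dehn_part_nframed ?scaler0 // => /(framed_conjugate g^-1%g).
  by rewrite conjugateK.
rewrite /dehn_part -(oriented_dehn_lorentz dim_sum) //; last first.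
  by move=> k; exact: fixed_vertex_hyperbolic.
congr oriented_dehn; apply/trmx_inj/row_matrixP => k; rewrite -!tr_col; congr trmx.
rewrite col_scale_mul [in RHS]col_vertex_mx -vertex_vector_translate.
exact: col_vertex_mx.
Qed.

Lemma dehn_cochain_translate g v :
  dehn_cochain (translate g \o v) = det_sign g *: dehn_cochain v.
Proof.
pose F P := dehn_part P (translate g \o v).
transitivity (\sum_(P \in [set: 'M[R]_d.+1]) F (conjugate g P)).
  apply: (reindex_fsbigT (conjugate g) F).
  by exists (conjugate g^-1%g); [exact: conjugateK | exact: conjugateVK].
rewrite /dehn_cochain (fsum_scale _ (dehn_part_support v)).
by apply: eq_fsbigr => P _; rewrite /F dehn_part_translate.
Qed.

Lemma dehn_cochain_first : depends_on_first d.+1 dehn_cochain.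
Proof.
move=> v w vw; apply: eq_fsbigr => P _; rewrite /dehn_part; congr oriented_dehn.
by apply/matrixP => r k; rewrite !mxE vw.
Qed.

Lemma dehn_cochain_cocycle v : coboundary d.+1 dehn_cochain v = 0.
Proof.
rewrite /coboundary /dehn_cochain fsum_exchange => [|q]; last exact: dehn_part_support.
apply: fsbig1 => P _; have [fP|nfP] := pselect (framed i m P); last first.
  by apply: big1 => q _; rewrite dehn_part_nframed ?scaler0.
rewrite -[RHS](oriented_dehn_cocycle dim_sum d_odd (W := vertex_mx d.+2 P v)
   (fun k => fixed_vertex_hyperbolic fP)).
apply: eq_bigr => q _; congr (_ *: oriented_dehn _ _ _ _).
by apply/matrixP => r k; rewrite !mxE.
Qed.

(** No substitute vertex lies in its subspace, whereas a nonzero term needs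
    [i + 1] of them there. *)
Lemma dehn_cochain_false (u : nat -> G) : dehn_cochain (fun j => (u j, false)) = 0.
Proof.
apply: fsbig1 => P _; have [fP|] := pselect (framed i m P); last exact: dehn_part_nframed.
apply: oriented_dehn_card; rewrite (_ : fixed _ _ = finset.set0) ?cards0 //.
apply/finset.setP => k; rewrite finset.in_set0; apply/negP => /(fixed_vertex fP).
by case.
Qed.

Definition orbit_mx (u : nat -> G) : 'M[R]_d.+1 :=
  \matrix_(r, j) orbit_point (u j) r 0.

Lemma vertex_mx_true P u : vertex_mx d.+1 P (fun j => (u j, true)) = orbit_mx u.
Proof. by apply/matrixP => r j; rewrite !mxE. Qed.

Section DehnInvariant.
Variable D : {linear PH R d -> tensor (PH R i) (PS R m)}.
Hypothesis hD : forall (x : 'M[R]_d.+1)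
    (A : {set 'I_d.+1} -> 'M[R]_(d.+1, i.+1)) (B : {set 'I_d.+1} -> 'M[R]_(d.+1, m.+1)),
  x \in unitmx -> (forall j, hyperbolic R d (col j x)) ->
  (forall I : {set 'I_d.+1}, #|I| = i.+1 -> adapted_frame x I (A I) (B I)) ->
  D (hclass (simplex (hyperbolic R d) x)) =
    \sum_(I : {set 'I_d.+1} | #|I| == i.+1) dehn_term x I (A I) (B I).

(** For independent vertices the subspaces that contribute correspond to the sets
    of [i + 1] vertices. For dependent ones both sides vanish with the
    orientation. *)
Lemma dehn_cochain_true (u : nat -> G) :
  dehn_cochain (fun j => (u j, true)) = D (oriented_class (orbit_mx u)).
Proof.
have hY k : hyperbolic R d (col k (orbit_mx u)).
  rewrite (_ : col k _ = orbit_point (u k)); first exact: orbit_point_hyperbolic.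
  by apply/colP => r; rewrite !mxE.
have [Yu|nYu] := boolP (orbit_mx u \in unitmx); last first.
  rewrite /oriented_class orientation_odd //; move: (nYu).
  rewrite unitmx_det negbK => /eqP ->; rewrite sgz0 scale0r linear0.
  apply: fsbig1 => P _; apply/eqP; apply: contraNT nYu.
  by move=> /dehn_part_neq0[_ _]; rewrite vertex_mx_true.
have /choice[AB ABP] (I : {set 'I_d.+1}) : exists AB : 'M[R]_(d.+1, i.+1) * 'M[R]_(d.+1, m.+1),
    #|I| = i.+1 -> frame AB.1 AB.2 /\ fixed (projector AB.1) (orbit_mx u) = I.
  have [cardI|cardI] := eqVneq #|I| i.+1; last by exists (0, 0) => /eqP; rewrite (negPf cardI).
  by have [A [B AB]] := exists_frame dim_sum Yu hY cardI; exists (A, B).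
rewrite /oriented_class linearZ /= (hD (A := fun I => (AB I).1) (B := fun I => (AB I).2)) //; last first.
  move=> I cardI; have [[AA A0 BB A_B] fixI] := ABP I cardI; split=> // j.
  rewrite -{1}fixI inE => /eqP fixj; exists (coordA (AB I).1 *m col j (orbit_mx u)).
  by rewrite mulmxA -[LHS]fixj.
pose Is := [seq K : {set 'I_d.+1} <- enum {set 'I_d.+1} | #|K| == i.+1].
have cardIs I : I \in Is -> #|I| = i.+1 by rewrite mem_filter => /andP[/eqP].
have proj_inj : {in Is &, injective (fun I => projector (AB I).1)}.
  move=> I I' /cardIs cI /cardIs cI' /= PP.
  by rewrite -(ABP I cI).2 PP (ABP I' cI').2.
rewrite /dehn_cochain (fsum_cover (s := [seq projector (AB K).1 | K <- Is])); last first.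
  move=> P /dehn_part_neq0[[[A B] [/= AB' PA]]].
  rewrite vertex_mx_true => cardF _; set I := fixed P _ in cardF.
  have [ABI fixI] := ABP I cardF.
  apply/mapP; exists I; first by rewrite mem_filter cardF eqxx mem_enum.
  rewrite -PA; apply: (projector_unique AB' ABI cardF).
  - exact: independentS (finset.subsetT _) (unitmx_independent Yu).
  - by move=> k; rewrite PA inE => /eqP.
  - by move=> k; rewrite -{1}fixI inE => /eqP.
rewrite undup_id; last by rewrite map_inj_in_uniq // filter_uniq // enum_uniq.
rewrite big_map big_filter big_enum_cond /= scaler_sumr; apply: eq_bigr => I /eqP cardI.
have [ABI fixI] := ABP I cardI.
by rewrite /dehn_part vertex_mx_true (oriented_dehnE dim_sum d_odd ABI) fixI.
Qed.

(** The Dehn invariant of the oriented simplex is the coboundary of the prism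
    cochain, hence vanishes on cycles. *)
Lemma dehn_ccs_chain (z : bar_cycle (@det_sign R d) d) : D (ccs_chain x0 z) = 0.
Proof.
pose F := prism (fun g : G => (g, false)) (fun g => (g, true)) d dehn_cochain.
have Fn : depends_on_first n.+1 F by exact: prism_first dehn_cochain_first.
have Fequiv : equivariant (@det_sign R d) F.
  by apply: (prism_equivariant (act := translate)) => // h v; exact: dehn_cochain_translate.
have /eqP z0 : bar_boundary (@det_sign R d) z == 0 by case: z.
have := fglift_bar_boundary (cycle_chain z) (@det_sign_sqr R d) Fn Fequiv.
rewrite z0 fglift_sumE dom0 big_nil => /esym/eqP; rewrite -signr_odd.
have coboundaryE (g : n.+1.-tuple G) :
    coboundary n.+1 F (vertex g) = D (oriented_class (ccs_vertices x0 g)).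
  rewrite coboundary_prism; [|exact: dehn_cochain_first|exact: dehn_cochain_cocycle].
  by rewrite dehn_cochain_false subr0 dehn_cochain_true.
have -> : fglift (fun g => coboundary n.+1 F (vertex g)) (cycle_chain z) = D (ccs_chain x0 z).
  rewrite /ccs_chain !fglift_sumE linear_sum; apply: eq_bigr => g _.
  by rewrite linearZ coboundaryE.
by rewrite scaler_sign; case: ifP => _; rewrite ?oppr_eq0 => /eqP.
Qed.

End DehnInvariant.
End DehnCochain.

(** * The Cheeger-Chern-Simons homomorphism *)

Lemma ccs_chain_even (R : realType) (d : nat) (x0 : 'cV[R]_d.+1) z :
  ~~ odd d -> ccs_chain x0 z = 0.
Proof.
move=> d_even; rewrite /ccs_chain fglift_sumE big1 // => g _.
by rewrite /oriented_class /orientation (negPf d_even) scale0r scaler0.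
Qed.

(** The points of the orbit of [x0] turn the cocycle relation of the oriented
    simplex into the vanishing of a homogeneous coboundary. *)
Lemma ccs_chain_boundary (R : realType) (d : nat) (x0 : 'cV[R]_d.+1)
    (w : bar_chain (lorentz R d) zhalf d.+1) : hyperbolic R d x0 ->
  ccs_chain x0 (bar_boundary (@det_sign R d) w) = 0.
Proof.
move=> hx0; have [d_odd|d_even] := boolP (odd d); last exact: ccs_chain_even.
pose orbit p (u : nat -> lorentz R d) : 'M[R]_(d.+1, p) :=
  \matrix_(r < d.+1, j < p) lorentz_act (u j) x0 r 0.
have col_orbit p u k : col k (orbit p u) = lorentz_act (u k) x0.
  by apply/colP => r; rewrite !mxE.
pose F u := oriented_class (orbit d.+1 u).
have Fn : depends_on_first d.+1 F.
  by move=> u v uv; congr oriented_class; apply/matrixP => r j; rewrite !mxE uv.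
have Fequiv : equivariant (@det_sign R d) F.
  move=> h u; rewrite /F -oriented_class_lorentz // => [|k]; last first.
    by rewrite col_orbit; exact: lorentz_act_hyperbolic.
  congr oriented_class; apply/trmx_inj/row_matrixP => k; rewrite -!tr_col; congr trmx.
  rewrite linearZ /= col_mul !col_orbit lorentz_actM //.
  by have [] := lorentz_actE h (lorentz_act_hyperbolic (u k) hx0).
have := fglift_bar_boundary w (@det_sign_sqr R d) Fn Fequiv.
rewrite (_ : fglift (fun g => F (vertex g)) = ccs_chain x0) // => ->.
rewrite fglift_sumE big1 ?scaler0 // => g _.
rewrite (_ : coboundary _ _ _ = 0) ?scaler0 //.
rewrite -[RHS](oriented_class_cocycle (W := orbit d.+2 (vertex g)) d_odd) => [|k]; last first.
  by rewrite col_orbit; exact: lorentz_act_hyperbolic.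
apply: eq_bigr => q _; congr (_ *: oriented_class _).
by apply/matrixP => r k; rewrite !mxE.
Qed.

Lemma exists_ccs (R : realType) (d : nat) (x0 : 'cV[R]_d.+1) : hyperbolic R d x0 ->
  exists ccs : {linear HO R d d -> PH R d}, is_ccs x0 ccs.
Proof.
move=> hx0; pose phi (z : bar_cycle (@det_sign R d) d) : PH R d := ccs_chain x0 z.
have phi_linear : linear phi by move=> a u v; rewrite /phi /ccs_chain -fglift_linear.
pose L := GRing.isLinear.Build zhalf _ (PH R d) *:%R phi phi_linear.
pose Phi : {linear bar_cycle (@det_sign R d) d -> PH R d} := HB.pack_for {linear _ -> _} phi L.
have [|ccs ccsE] := @lquot_lift zhalf _ _ (@is_boundary _ _ (@det_sign R d) d) Phi.
  by move=> z [w zw]; rewrite /Phi /= /phi zw ccs_chain_boundary.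
by exists ccs => z; rewrite /homology_class ccsE.
Qed.

Theorem theoremA (R : realType) (d : nat)
    (vol : {additive PH R d -> R})
    (hvol : is_volume vol)
    (D : forall i : nat, {linear PH R d -> tensor (PH R i) (PS R (d - i - 1))})
    (hD : forall i : nat, (0 < i < d)%N -> is_dehn (D i))
    (x0 : 'cV[R]_d.+1)
    (hx0 : hyperbolic R d x0) :
  exists ccs : {linear HO R d d -> PH R d},
    is_ccs x0 ccs /\
    let CCS := fun h : HO R d d => vol (ccs h) in
    let kerD := fun x : PH R d => forall i : nat, (0 < i < d)%N -> D i x = 0 in
    exists f : {linear HO R d d -> PH R d},
      [/\ forall h, kerD (f h),
          forall h, vol (f h) = CCS h &
          (forall x, kerD x -> exists h, f h = x) -> injective CCS ->
          forall x y : PH R d,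
            vol x = vol y ->
            (forall i : nat, (0 < i < d)%N -> D i x = D i y) ->
            x = y].
Proof.
have [ccs ccsE] := exists_ccs hx0; exists ccs; split=> //= .
exists ccs; split=> // [h i id|surj inj x y volxy Dxy].
  have -> : h = homology_class (repr (h : Quotient.quot _)) by rewrite /homology_class lclassK.
  rewrite ccsE; have [d_odd|d_even] := boolP (odd d); last by rewrite ccs_chain_even ?linear0.
  case: d D hD x0 hx0 {vol hvol ccs ccsE} h id d_odd => // n D hD x0 hx0 h id d_odd.
  apply: (dehn_ccs_chain _ d_odd hx0); [by lia | exact: hD].
have [i id|h hxy] := surj (x - y); first by rewrite linearB /= Dxy // subrr.
suff h0 : h = 0 by apply/eqP; rewrite -subr_eq0 -hxy h0 linear0.
by apply: inj; rewrite hxy linear0 !raddfB volxy subrr raddf0.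
Qed.
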